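(* Let $G$ be a 1-planar graph with $n$ vertices, given together with a fixed 1-planar drawing (specified as described in the context). Then an edge-partition $E(G)=A\cup B$, $A\cap B=\emptyset$, such that the subgraph formed by the edges of $A$ is planar and the subgraph formed by the edges of $B$ is a forest, can be computed in $O(n)$ time.
   Context: All graphs are finite and connected. A 1-planar graph is a graph that can be drawn in the plane (in a good drawing: no edge crosses itself and edges sharing an endpoint do not cross) such that every edge crosses at most one other edge. The planarization of a drawing is the plane graph obtained by replacing each crossing point by a new vertex. The input drawing is specified by the planarization, given by the rotational clockwise order of edges at each vertex, with the vertices arising from crossing points marked as such. *)

(* Defs.v *)
From mathcomp Require Import all_boot.

Set Implicit Arguments.
Unset Strict Implicit.
Unset Printing Implicit Defensive.

(** * Finite simple graphs

    A graph on the vertex set [V] is given by its edge set, each edge being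
    the set of its two ends. *)

Section Graphs.
Variable V : finType.
Implicit Types E : {set {set V}}.

Definition simple_graph E := forall e, e \in E -> #|e| = 2.

Definition adj E : rel V := fun u v => [set u; v] \in E.

(* The empty graph is not connected. *)
Definition connected_graph E := 0 < #|V| /\ forall u v, connect (adj E) u v.

(* Cyclic sequences of size 2 run back and forth along one edge. *)
Definition forest E := forall s : seq V, ucycle (adj E) s -> size s <= 2.

End Graphs.

(** * Rotation systems

    Every edge is made of two opposite darts (oriented edges).  [org d] is
    the vertex that the dart [d] leaves, [twin d] is the opposite dart, and
    [next d] is the dart that follows [d] in the clockwise order around
    [org d].  Vertices without darts are allowed. *)

Record rotation_system (X D : Type) := RotationSystem {
  org : D -> X;
  twin : D -> D;
  next : D -> D
}.

Section Plane.
Variables X D : finType.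
Implicit Type R : rotation_system X D.

(* The last clause says that [next] runs cyclically through all the darts
   at a vertex; in particular [next] is a permutation of [D]. *)
Definition rotation_axioms R :=
  [/\ involutive (twin R),
      forall d, twin R d != d,
      injective (next R)
    & forall d d', fconnect (next R) d d' = (org R d == org R d')].

(* Arriving along [d], the boundary walk of a face leaves by the edge which
   follows at the vertex reached. *)
Definition face R (d : D) : D := next R (twin R d).

Definition linked R : rel D := fun d d' => (d' == twin R d) || (d' == next R d).

(* Euler's formula V - E + F = 2C, where E = #|D| - fcard twin.  Everything is
   counted on darts, so vertices without darts play no role. *)
Definition genus_zero R :=
  fcard (next R) predT + fcard (twin R) predT + fcard (face R) predT
    = #|D| + 2 * n_comp (linked R) predT.

Definition plane_rotation R := rotation_axioms R /\ genus_zero R.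

End Plane.

(* A graph is planar when it has a crossing-free drawing, that is, a rotation
   system of genus zero in which every edge [set u; v] is represented by
   exactly one dart from u to v (and one from v to u). *)
Definition planar (V : finType) (E : {set {set V}}) :=
  exists (D : finType) (R : rotation_system V D),
    plane_rotation R /\
    forall u v, #|[set d | (org R d == u) && (org R (twin R d) == v)]|
                = ([set u; v] \in E).

(** * 1-planar drawings, given by their planarizations *)

Record planarization (X D : Type) := Planarization {
  rot :> rotation_system X D;
  crossing : X -> bool  (* the vertices which arise from crossing points *)
}.

Section Drawing.
Variables X D : finType.
Implicit Type P : planarization X D.

(* Let [d] leave a vertex of the drawn graph.  It is an end segment of a drawn
   edge, and [far P d] is the dart which leaves the other end of that edge
   along it.  At a crossing, of degree four, the edge goes on along the
   opposite segment, two steps further in the rotation. *)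
Definition far P (d : D) : D :=
  let d' := twin P d in
  if crossing P (org P d') then twin P (next P (next P d')) else d'.

Variable V : finType.

(* [P] is the planarization of a good 1-planar drawing of the graph E, where
   the vertex v of the graph is the vertex [rv v] of the planarization. *)
Record one_planar_drawing (E : {set {set V}}) P (rv : V -> X) : Prop := {
  opd_plane : plane_rotation P;
  opd_rv_inj : injective rv;
  opd_rv_codom : forall x, (x \in codom rv) = ~~ crossing P x;
  opd_degree : forall x, crossing P x -> #|[set d | org P d == x]| = 4;
  (* no edge is crossed twice *)
  opd_crossed_once : forall d,
    crossing P (org P d) -> ~~ crossing P (org P (twin P d));
  (* two crossing edges have four distinct ends *)
  opd_good : forall d d', crossing P (org P d) -> org P d = org P d' ->
    org P (twin P d) = org P (twin P d') -> d = d';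
  (* the drawn edges are the edges of the graph, each drawn once *)
  opd_edges : forall u v,
    #|[set d | (org P d == rv u) && (org P (far P d) == rv v)]|
      = ([set u; v] \in E)
}.

End Drawing.

(** * A random access machine

    The memory consists of arrays of natural numbers, named by natural
    numbers; a program mentions finitely many of them.  The cell 0 of an array
    may serve as a scalar variable.  Arithmetic operations and memory accesses
    at computed indices take unit time.  Control flow is structured. *)

Definition memory := nat -> nat -> nat.

Inductive expr :=
| Const of nat
| Read of nat & expr            (* Read a i : the cell i of the array a *)
| Add of expr & expr
| Sub of expr & expr.           (* truncated subtraction *)

Inductive com :=
| Skip
| Store of nat & expr & expr    (* Store a i e : write e to cell i of a *)
| Seq of com & com
| If of expr & com & com        (* a condition holds when it is nonzero *)
| While of expr & com.

Fixpoint eval (m : memory) (e : expr) : nat :=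
  match e with
  | Const k => k
  | Read a i => m a (eval m i)
  | Add e1 e2 => eval m e1 + eval m e2
  | Sub e1 e2 => eval m e1 - eval m e2
  end.

(* Every value which occurs in the evaluation of [e], addresses included, is
   less than [W]. *)
Fixpoint fits (W : nat) (m : memory) (e : expr) : bool :=
  (eval m e < W) &&
  match e with
  | Const _ => true
  | Read _ i => fits W m i
  | Add e1 e2 | Sub e1 e2 => fits W m e1 && fits W m e2
  end.

Fixpoint cost (e : expr) : nat :=
  match e with
  | Const _ => 1
  | Read _ i => (cost i).+1
  | Add e1 e2 | Sub e1 e2 => (cost e1 + cost e2).+1
  end.

Definition update (m : memory) (a i x : nat) : memory :=
  fun a' i' => if (a' == a) && (i' == i) then x else m a' i'.

(* [exec W c m t m'] : on a machine whose words hold the numbers less than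
   [W], the program [c] started in [m] halts in [m'] after [t] steps, without
   any overflow. *)
Inductive exec (W : nat) : com -> memory -> nat -> memory -> Prop :=
| ExecSkip m : exec W Skip m 1 m
| ExecStore a i e m :
    fits W m i -> fits W m e ->
    exec W (Store a i e) m (cost i + cost e).+1
         (update m a (eval m i) (eval m e))
| ExecSeq c1 c2 m m1 m2 t1 t2 :
    exec W c1 m t1 m1 -> exec W c2 m1 t2 m2 ->
    exec W (Seq c1 c2) m (t1 + t2).+1 m2
| ExecIfTrue e c1 c2 m m' t :
    fits W m e -> eval m e != 0 -> exec W c1 m t m' ->
    exec W (If e c1 c2) m (cost e + t).+1 m'
| ExecIfFalse e c1 c2 m m' t :
    fits W m e -> eval m e == 0 -> exec W c2 m t m' ->
    exec W (If e c1 c2) m (cost e + t).+1 m'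
| ExecWhileTrue e c m m1 m2 t1 t2 :
    fits W m e -> eval m e != 0 ->
    exec W c m t1 m1 -> exec W (While e c) m1 t2 m2 ->
    exec W (While e c) m (cost e + t1 + t2).+1 m2
| ExecWhileFalse e c m :
    fits W m e -> eval m e == 0 ->
    exec W (While e c) m (cost e).+1 m.

(** * Input and output *)

(* The array with the values of [f] on 0, ..., n - 1, followed by zeros. *)
Definition tabulate (n : nat) (f : 'I_n -> nat) (i : nat) : nat :=
  if insub i is Some j then f j else 0.

(* Array 0 holds the numbers of vertices and of darts of the planarization;
   arrays 1 to 4 hold [org], [twin], [next] and the marks of the crossings.
   All other cells are zero. *)
Definition input (nv nd : nat) (P : planarization 'I_nv 'I_nd) : memory :=
  fun a => match a with
  | 0 => nth 0 [:: nv; nd]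
  | 1 => tabulate (fun d => org P d)
  | 2 => tabulate (fun d => twin P d)
  | 3 => tabulate (fun d => next P d)
  | 4 => tabulate (fun x => crossing P x)
  | _ => fun=> 0
  end.

(* Array 5 holds the class of every edge of the graph, 0 for A and 1 for B,
   at each of the two darts by which the edge leaves its ends. *)
Definition outputs (V : finType) (nv nd : nat) (P : planarization 'I_nv 'I_nd)
    (rv : V -> 'I_nv) (m : memory) (A B : {set {set V}}) :=
  forall (u v : V) (d : 'I_nd), org P d = rv u -> org P (far P d) = rv v ->
    (m 5 d = 0 <-> [set u; v] \in A) /\ (m 5 d = 1 <-> [set u; v] \in B).

(* Main.v *)
From mathcomp Require Import all_boot ssralg zmodp matrix mxalgebra zify.
Require Import Defs.

Set Implicit Arguments.
Unset Strict Implicit.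
Unset Printing Implicit Defensive.

(* At every crossing one of the two crossing edges is put into B, so that the
   edges of A do not cross. Call two consecutive corners of a crossing a side. A
   set F of chosen edges is kept such that F is a forest and no side joins two
   vertices of one component of F. An edge may be added to F unless its ends lie
   in components of F which are equal or joined by a side. If this obstacle occurs
   for both edges at an unused crossing, there are two closed curves, each through
   one of these edges, edges of F and a side drawn next to a crossing, which meet
   exactly once, against planarity. Planarity is used in homological form: the
   genus is zero iff every cycle modulo two bounds a set of faces. The same
   criterion shows that deleting edges keeps a rotation system plane.

   In linear time no union-find structure is available. Therefore the components
   are grown one after the other: the far end of an undecided edge at the current
   component is never in an older component, so that marking the vertices in and
   beside the current component detects every obstacle. Edges of B chosen because
   the other edge was obstructed are ignored during the search: the obstruction
   persists, and allows to add them at the end. *)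

(** * Rotation systems and their homology *)

(** The drawing is purely combinatorial, so the Jordan curve theorem is replaced by a potential: for
    every cycle modulo two there is a two-colouring [g] of the faces which changes exactly across
    the cycle. Accordingly a side is drawn in two ways. In the first curve it consists of two
    half-edges through its crossing point, so that it is a chain of the planarization; in the second
    it is a step inside one corner of a crossing, along which [g] is compared. The condition that no
    side joins two vertices of one component makes the components at the ends of one crossing edge
    disjoint from those at the ends of the other; this keeps the two curves from meeting a second
    time.

    The bound on the input size is a by-product of the algorithm. The abstract algorithm stops after
    at most three steps per dart, and its result splits the edges into two simple plane graphs;
    Euler's formula for each of them bounds [nd] linearly in [#|V|]. The marks carry the number of
    the component which set them, so nothing has to be erased between two components. *)

Section InvariantVectors.
Variable D : finType.
Implicit Types (e : rel D) (v : 'rV[bool]_#|D|).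
Import GRing.Theory.
Local Open Scope ring_scope.

Definition coord v (d : D) : bool := v 0 (enum_rank d).

Lemma coordE v i : v 0 i = coord v (enum_val i).
Proof. by rewrite /coord enum_valK. Qed.

Definition vec (f : D -> bool) : 'rV[bool]_#|D| := \row_i f (enum_val i).

Lemma coord_vec f d : coord (vec f) d = f d.
Proof. by rewrite /coord mxE enum_rankK. Qed.

(** The rows are the indicator vectors of the components of [e]: the row space consists of the
    vectors constant on components, and multiplication by the transpose sums a vector over each
    component. *)
Definition component_mx e : 'M[bool]_(#|roots e|, #|D|) :=
  \matrix_(i, j) (fingraph.root e (enum_val j) == enum_val i).

Lemma rank_component_mx e :
  connect_sym e -> \rank (component_mx e) = n_comp e predT.
Proof.
move=> esym; transitivity #|roots e|; last first.
  by apply: eq_card => x; rewrite !inE andbT.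
apply/eqP; apply/row_freeP.
(* The right inverse reads every row at the root of its own component. *)
exists (\matrix_(j, i) (enum_val j == enum_val i)); apply/matrixP => i i'.
rewrite !mxE (bigD1 (enum_rank (enum_val i'))) //= !mxE !enum_rankK eqxx mulr1.
rewrite (eqP (enum_valP i')) big1 ?addr0 => [|j ne_j].
  by rewrite (inj_eq enum_val_inj) eq_sym; case: eqP.
rewrite !mxE (_ : _ == enum_val i' = false) ?mulr0 //.
by apply: contraNF ne_j => /eqP <-; rewrite enum_valK.
Qed.

Lemma sub_component_mx e v : connect_sym e ->
  reflect (forall d d', e d d' -> coord v d = coord v d') (v <= component_mx e)%MS.
Proof.
move=> esym; apply: (iffP idP) => [/submxP[w ->] d d' edd'|inv_v].
  rewrite /coord !mxE; apply: eq_bigr => i _; rewrite !mxE !enum_rankK.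
  suff -> : fingraph.root e d = fingraph.root e d' by [].
  by apply/eqP; rewrite root_connect //; apply: connect1.
have inv_root d : coord v d = coord v (fingraph.root e d).
  have /connectP[p] := connect_root e d.
  move: (fingraph.root e d) => r.
  by elim: p d => [|d1 p IHp] d /= => [_ ->|/andP[/inv_v-> /IHp]].
apply/submxP; exists (\row_i coord v (enum_val i)); apply/matrixP => k j.
rewrite (ord1 k) coordE inv_root !mxE.
have rt : roots e (fingraph.root e (enum_val j)) by apply: roots_root.
rewrite (bigD1 (enum_rank_in rt (fingraph.root e (enum_val j)))) //= !mxE.
rewrite enum_rankK_in // eqxx mulr1 big1 ?addr0 // => i ne_i; rewrite !mxE.
rewrite (_ : _ == enum_val i = false) ?mulr0 //.
by apply: contraNF ne_i => /eqP E; apply/eqP/enum_val_inj; rewrite enum_rankK_in.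
Qed.

Lemma component_mx_sum e v d : connect_sym e -> v *m (component_mx e)^T = 0 ->
  \sum_(d' | connect e d d') coord v d' = 0.
Proof.
move=> esym /matrixP v0.
have rt : roots e (fingraph.root e d) by apply: roots_root.
have:= v0 0 (enum_rank_in rt (fingraph.root e d)); rewrite !mxE => v0d.
rewrite -[RHS]v0d (reindex_onto enum_rank enum_val) => [|i _]; last exact: enum_valK.
rewrite big_mkcond [RHS]big_mkcond; apply: eq_bigr => d' _.
rewrite !mxE !enum_rankK eqxx enum_rankK_in // root_connect // esym /coord.
by case: connect; rewrite ?mulr1 ?mulr0.
Qed.

Lemma component_mx_kernel e v : connect_sym e ->
  (forall d, \sum_(d' | connect e d d') coord v d' = 0) ->
  v *m (component_mx e)^T = 0.
Proof.
move=> esym v0; apply/matrixP => k i; rewrite (ord1 k) !mxE -[RHS](v0 (enum_val i)).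
rewrite (reindex_onto enum_rank enum_val) => [|j _]; last exact: enum_valK.
rewrite big_mkcond [RHS]big_mkcond; apply: eq_bigr => d' _.
rewrite !mxE !enum_rankK eqxx -[X in _ == X](eqP (enum_valP i)) root_connect // esym.
by rewrite /coord; case: connect; rewrite ?mulr1 ?mulr0.
Qed.

End InvariantVectors.

Section Homology.
Variables (X D : finType) (R : rotation_system X D).
Import GRing.Theory.

(** An element of the cycle space modulo two: a set of edges, stored as a [twin]-invariant set of
    darts, with an even number of darts at every vertex. No closed walk is singled out. *)
Definition dart_cycle (z : D -> bool) :=
  (forall d, z (twin R d) = z d) /\
  forall x, \big[addb/false]_(d | org R d == x) z d = false.

Hypothesis ax : rotation_axioms R.

Let twinK : involutive (twin R). Proof. by case: ax. Qed.
Let twin_neq d : twin R d != d. Proof. by case: ax. Qed.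
Let next_inj : injective (next R). Proof. by case: ax. Qed.
Let org_orbit d d' : fconnect (next R) d d' = (org R d == org R d').
Proof. by case: ax. Qed.

Lemma face_inj : injective (face R).
Proof. by move=> d d' /next_inj /(inv_inj twinK). Qed.

Let twin_sym := fconnect_sym (inv_inj twinK).
Let next_sym := fconnect_sym next_inj.
Let face_sym := fconnect_sym face_inj.

Lemma linked_sym : connect_sym (linked R).
Proof.
suff sym d d' : connect (linked R) d d' -> connect (linked R) d' d.
  by move=> d d'; apply/idP/idP; apply: sym.
have next_linked a b : fconnect (next R) a b -> connect (linked R) a b.
  apply: connect_sub => {}a _ /eqP <-.
  by apply: connect1; rewrite /linked eqxx orbT.
case/connectP=> p; elim: p d => [|d1 p IHp] d /= => [_ ->|/andP[dd1 pth]] //.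
move=> Ed'; apply: connect_trans (IHp _ pth Ed') _.
case/orP: dd1 => /eqP ->; last by rewrite next_linked // next_sym fconnect1.
by apply: connect1; rewrite /linked twinK eqxx.
Qed.

Lemma twin_connect d d' : fconnect (twin R) d d' = (d' == d) || (d' == twin R d).
Proof.
apply/idP/orP=> [/iter_findex <-|[] /eqP->]; rewrite ?connect0 ?fconnect1 //.
elim: findex => [|n [] /eqP IHn] /=; first by left.
  by rewrite IHn eqxx; right.
by rewrite IHn twinK; left.
Qed.

(** The orbits of [twin] have two elements, so in characteristic two invariance under [twin] says
    that the sum over each orbit vanishes, just as evenness at the vertices does for the orbits of
    [next]. *)
Lemma dart_cycle_kernel (v : 'rV[bool]_#|D|) :
  dart_cycle (coord v) <->
  (v *m (component_mx (frel (twin R)))^T = 0 /\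
   v *m (component_mx (frel (next R)))^T = 0)%R.
Proof.
have sum_twin d : (\sum_(d' | fconnect (twin R) d d') coord v d')%R
    = (coord v d + coord v (twin R d))%R.
  rewrite (bigD1 d) ?connect0 //= (big_pred1 (twin R d)) // => d'.
  by rewrite twin_connect; case: (eqVneq d' d) => [->|_] /=;
    rewrite ?andbF ?andbT // eq_sym (negPf (twin_neq d)).
split=> [[vT v0]|[/component_mx_sum vT /component_mx_sum vN]].
  split; apply: component_mx_kernel => // d; first by rewrite sum_twin vT; case: coord.
  by rewrite -[RHS](v0 (org R d)); apply: eq_bigl => d'; rewrite org_orbit eq_sym.
split=> [d|x].
  by have := vT d twin_sym; rewrite sum_twin; do 2!case: coord.
have [d /eqP <-|no_d] := pickP (fun d => org R d == x).
  rewrite -[RHS](vN d) //; apply: eq_bigl => d'.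
  by rewrite org_orbit eq_sym.
by rewrite big_pred0.
Qed.

(* Over the field with two elements, the cycle space is the orthogonal of the
   sum of the twin-invariant and of the next-invariant vectors, so it has
   dimension #|D| - E - V + C; the boundaries of faces span a subspace of
   dimension F - C.  Euler's formula says that the dimensions agree. *)
Theorem genus_zero_cycles :
  genus_zero R <->
  forall z, dart_cycle z -> exists g : D -> bool,
    (forall d, g (face R d) = g d) /\ (forall d, z d = g d (+) g (twin R d)).
Proof.
pose MT := component_mx (frel (twin R)); pose MN := component_mx (frel (next R)).
pose MF := component_mx (frel (face R)); pose ML := component_mx (linked R).
(* The boundary operator: the image of a labelling has at [d] the sum of the labels on the two sides
   of the edge of [d]. *)
pose Q : 'M[bool]_#|D| :=
  (1%:M + \matrix_(i, j) (enum_val i == twin R (enum_val j)))%R.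
have coordQ v d : coord (v *m Q)%R d = coord v d (+) coord v (twin R d).
  rewrite /coord mulmxDr mulmx1 mxE; congr (_ + _)%R; rewrite !mxE.
  rewrite (bigD1 (enum_rank (twin R d))) //= !mxE !enum_rankK eqxx mulr1.
  rewrite big1 ?addr0 // => i ne_i; rewrite !mxE enum_rankK.
  rewrite (_ : _ == _ = false) ?mulr0 //.
  by apply: contraNF ne_i => /eqP <-; rewrite enum_valK.
have invP f (v : 'rV[bool]_#|D|) : injective f ->
    reflect (forall d, coord v (f d) = coord v d) (v <= component_mx (frel f))%MS.
  move=> f_inj; apply: (iffP (sub_component_mx _ (fconnect_sym f_inj))).
    by move=> inv_v d; rewrite (inv_v d (f d)) //=.
  by move=> inv_v d d' /eqP <-.
have invLP (v : 'rV[bool]_#|D|) : reflect ((forall d, coord v (twin R d) = coord v d)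
    /\ (forall d, coord v (next R d) = coord v d)) (v <= ML)%MS.
  apply: (iffP (sub_component_mx _ linked_sym)).
    move=> inv_v; split=> d; first by rewrite (inv_v d (twin R d)) ?/linked ?eqxx.
    by rewrite (inv_v d (next R d)) ?/linked ?eqxx ?orbT.
  by case=> vT vN d d' /orP[] /eqP ->.
have twin_inj := inv_inj twinK.
have capTN : (MT :&: MN :=: ML)%MS.
  apply/eqmxP/andP; split; apply/rV_subP => v; rewrite sub_capmx.
    by case/andP=> /invP-/(_ twin_inj) vT /invP-/(_ next_inj) vN; apply/invLP.
  by case/invLP=> vT vN; apply/andP; split; [apply/(invP (twin R)) | apply/(invP (next R))].
(* A labelling of faces has zero boundary iff it is also [twin]-invariant, hence constant on
   components. This is the rank lost between faces and boundaries. *)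
have capFQ : (MF :&: kermx Q :=: ML)%MS.
  have kerQ (v : 'rV[bool]_#|D|) :
      (v <= kermx Q)%MS <-> (forall d, coord v (twin R d) = coord v d).
    split=> [/sub_kermxP v0 d|vT].
      by have := coordQ v d; rewrite v0 /coord mxE; do 2!case: (v _ _).
    apply/sub_kermxP/matrixP => k j; rewrite (ord1 k) coordE coordQ vT mxE.
    by case: coord.
  apply/eqmxP/andP; split; apply/rV_subP => v; rewrite sub_capmx.
    case/andP=> /invP-/(_ face_inj) vF /kerQ vT; apply/invLP; split=> // d.
    by rewrite -[d in LHS]twinK -/(face R _) vF vT.
  case/invLP=> vT vN; apply/andP; split; last exact/kerQ.
  by apply/(invP (face R) _ face_inj) => d; rewrite vN vT.
pose Z := kermx (col_mx MT MN)^T%R; pose B := (MF *m Q)%R.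
have ZP (v : 'rV[bool]_#|D|) : (v <= Z)%MS <-> dart_cycle (coord v).
  apply: (iff_trans _ (iff_sym (dart_cycle_kernel v))); split.
    move/sub_kermxP; rewrite tr_col_mx mul_mx_row => /eqP.
    by rewrite row_mx_eq0 => /andP[/eqP-> /eqP->].
  case=> vT vN; apply/sub_kermxP; rewrite tr_col_mx mul_mx_row.
  by rewrite vT vN row_mx0.
have BP (v : 'rV[bool]_#|D|) : (v <= B)%MS <-> exists g : D -> bool,
    (forall d, g (face R d) = g d) /\
    (forall d, coord v d = g d (+) g (twin R d)).
  split=> [/submxP[u ->]|[g [gF vE]]].
    exists (coord (u *m MF)%R); split=> [d|d]; last by rewrite /B mulmxA coordQ.
    by move: d; apply/(invP (face R) _ face_inj)/submxMl.
  have -> : v = (vec g *m Q)%R.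
    by apply/matrixP => k j; rewrite (ord1 k) !coordE coordQ !coord_vec.
  by apply: submxMr; apply/(invP (face R) _ face_inj) => d; rewrite !coord_vec.
have sBZ : (B <= Z)%MS.
  apply/rV_subP => v /BP[g [gF vE]]; apply/ZP; split=> [d|x].
    by rewrite !vE twinK addbC.
  (* By face invariance [g (twin R d) = g (next R d)], so around a vertex the sum of [g] meets its
     own shift and cancels. *)
  rewrite (eq_bigr (fun d => g d (+) g (next R d))) => [|d _]; last first.
    by rewrite vE -[d in next R d]twinK -/(face R _) gF.
  rewrite big_split /= (reindex_inj next_inj) /=.
  rewrite (eq_bigl (fun d => org R d == x)) ?addbb // => d; congr (_ == x).
  by apply/eqP; rewrite eq_sym -org_orbit fconnect1.
have Z_B : \rank Z = \rank B <-> (Z <= B)%MS.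
  have [_ EB] := mxrank_leqif_sup sBZ; rewrite -EB.
  by split=> [->|/eqP ->].
have rank_cap : \rank (col_mx MT MN) + n_comp (linked R) predT =
    fcard (next R) predT + fcard (twin R) predT.
  rewrite -addsmxE addnC -(rank_component_mx linked_sym) -capTN addnC.
  by rewrite mxrank_sum_cap !rank_component_mx // addnC.
have rank_B : \rank B + n_comp (linked R) predT = fcard (face R) predT.
  by rewrite -(rank_component_mx linked_sym) -capFQ mxrank_mul_ker rank_component_mx.
have le_n : \rank (col_mx MT MN) <= #|D| by apply: rank_leq_col.
transitivity (\rank Z = \rank B).
  move: rank_cap rank_B le_n; rewrite mxrank_ker mxrank_tr /genus_zero; lia.
rewrite Z_B; split=> [sZB z cz|hom].
  have /BP[g [gF zE]] : (vec z <= B)%MS.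
    apply: submx_trans sZB; apply/ZP; case: cz => zT z0; split=> [d|x].
      by rewrite !coord_vec.
    by rewrite -[RHS](z0 x); apply: eq_bigr => d _; rewrite coord_vec.
  by exists g; split=> // d; rewrite -zE coord_vec.
by apply/rV_subP => v /ZP /hom /BP.
Qed.

End Homology.

(** * Uncrossed parts of a drawing *)

Section FirstReturn.
Variables (D : finType) (f : D -> D) (S : {set D}).
Hypothesis f_inj : injective f.
Implicit Types u v : {d | d \in S}.

Lemma return_ex u : exists k, iter k.+1 f (val u) \in S.
Proof.
by exists (order f (val u)).-1; rewrite prednK ?order_gt0 // iter_order // (valP u).
Qed.

(** The number of elements outside [S] that are skipped, so the return itself takes one more
    application of [f]. *)
Definition return_time u := ex_minn (return_ex u).

Lemma first_returnP u : iter (return_time u).+1 f (val u) \in S.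
Proof. by rewrite /return_time; case: ex_minnP. Qed.

Lemma return_time_min u j : j < return_time u -> iter j.+1 f (val u) \notin S.
Proof.
rewrite /return_time; case: ex_minnP => k _ k_min; rewrite ltnNge.
exact/contra/k_min.
Qed.

Definition first_return u : {d | d \in S} :=
  exist (fun d => d \in S) _ (first_returnP u).

(** Of two points with the same first return, the one with the shorter return time lies on the way
    of the other and would be an earlier return to [S], unless they coincide. *)
Lemma first_return_inj : injective first_return.
Proof.
have iter_inj n : injective (iter n f) by elim: n => // n IHn x y /f_inj /IHn.
suff le_inj u v : return_time u <= return_time v ->
    first_return u = first_return v -> u = v.
  move=> u v Euv; case: (leqP (return_time u) (return_time v)) => [|/ltnW] le_uv.
    exact: le_inj.
  exact/esym/le_inj.
move=> le_uv /(congr1 val) /=; rewrite -!iterS => E.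
have {E} : val u = iter (return_time v - return_time u) f (val v).
  apply: (iter_inj (return_time u).+1); by rewrite E -iterD addSn subnKC.
case Ek: (_ - _) => [|k] Eu; first exact: val_inj.
have /return_time_min : k < return_time v by rewrite -ltnS -Ek ltnS leq_subr.
by rewrite -Eu (valP u).
Qed.

Lemma fconnect_first_return u v :
  fconnect first_return u v = fconnect f (val u) (val v).
Proof.
apply/idP/idP=> [/iter_findex <-|/iter_findex].
  elim: findex => [|n IHn]; [exact: connect0 | apply: connect_trans IHn _].
  exact: (fconnect_iter f (return_time _).+1).
move: (findex _ _ _) => m; elim/ltn_ind: m u => -[_ u /= /val_inj-> |n IHn u E].
  exact: connect0.
have le_n : return_time u <= n.
  rewrite leqNgt; apply/negP => /return_time_min; rewrite E.
  by rewrite (valP v).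
have lt_n : n - return_time u < n.+1 by rewrite ltnS leq_subr.
apply: connect_trans (fconnect1 _ _) (IHn _ lt_n _ _).
by rewrite -E -iterD addnS subnK.
Qed.

End FirstReturn.

(* The darts which lead to a crossing run around it under [turn], in the
   clockwise order of the segments. *)
Definition turn (X D : Type) (P : rotation_system X D) d := twin P (next P (twin P d)).

Definition real (X D : Type) (P : planarization X D) d := ~~ crossing P (org P d).

Definition crossed (X D : Type) (P : planarization X D) d :=
  crossing P (org P (twin P d)).

Section Drawing.
Variables (V X D : finType) (E : {set {set V}}) (P : planarization X D).
Variable rv : V -> X.
Hypothesis draw : one_planar_drawing E P rv.
Implicit Types (d e : D) (x y : X).

Local Notation org := (org P).
Local Notation twin := (twin P).
Local Notation next := (next P).
Local Notation turn := (turn P).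
Local Notation far := (far P).
Local Notation real := (real P).
Local Notation crossed := (crossed P).

Lemma drawing_axioms : rotation_axioms P. Proof. by case: (opd_plane draw). Qed.

Lemma twinK : involutive twin. Proof. by case: drawing_axioms. Qed.

Lemma twin_neq d : twin d != d. Proof. by case: drawing_axioms. Qed.

Lemma next_inj : injective next. Proof. by case: drawing_axioms. Qed.

Lemma org_orbit d e : fconnect next d e = (org d == org e).
Proof. by case: drawing_axioms. Qed.

Lemma org_next d : org (next d) = org d.
Proof. by apply/esym/eqP; rewrite -org_orbit fconnect1. Qed.

Lemma turn_inj : injective turn.
Proof. by move=> d e /(inv_inj twinK)/next_inj/(inv_inj twinK). Qed.

Lemma twin_turn d : twin (turn d) = next (twin d).
Proof. by rewrite /turn twinK. Qed.

Lemma twin_iter_turn n d : twin (iter n turn d) = iter n next (twin d).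
Proof. by elim: n => //= n IHn; rewrite twin_turn IHn. Qed.

Lemma org_twin_turn d : org (twin (turn d)) = org (twin d).
Proof. by rewrite twin_turn org_next. Qed.

Lemma crossed_turn d : crossed (turn d) = crossed d.
Proof. by rewrite /crossed org_twin_turn. Qed.

Lemma crossed_real d : crossed d -> real d.
Proof. by move=> /(opd_crossed_once draw); rewrite twinK. Qed.

Lemma order_crossing d : crossing P (org d) -> order next d = 4.
Proof.
move=> xd; rewrite -(opd_degree draw xd) /order; apply: eq_card => e.
by rewrite !inE org_orbit eq_sym.
Qed.

Lemma farE d : far d = if crossed d then turn (turn d) else twin d.
Proof. by rewrite /Defs.far /turn twinK. Qed.

Lemma far_crossed d : crossed d -> far d = turn (turn d).
Proof. by rewrite farE => ->. Qed.

Lemma turn4 d : crossed d -> turn (turn (turn (turn d))) = d.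
Proof.
move=> xd; apply: (inv_inj twinK); rewrite -[turn (turn _)]/(iter 4 turn d).
by rewrite twin_iter_turn -(order_crossing xd) iter_order //; apply: next_inj.
Qed.

Lemma turn_uniq d : crossed d -> uniq [:: d; turn d; turn (turn d); turn (turn (turn d))].
Proof.
move=> xd; rewrite -(map_inj_uniq (inv_inj twinK)).
have := orbit_uniq next (twin d); rewrite /orbit order_crossing //=.
by rewrite -!twin_turn.
Qed.

Lemma crossed_far d : crossed d -> crossed (far d).
Proof. by move=> xd; rewrite far_crossed // !crossed_turn. Qed.

Lemma real_far d : real d -> real (far d).
Proof.
move=> rd; rewrite farE; case: ifP => [xd|/negbT//].
by rewrite crossed_real ?crossed_turn.
Qed.

Lemma crossed_farE d : real d -> crossed (far d) = crossed d.
Proof.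
move=> rd; case xd: (crossed d); first exact: crossed_far.
by rewrite farE xd /crossed twinK (negPf rd).
Qed.

Lemma farK d : real d -> far (far d) = d.
Proof.
move=> rd; have := crossed_farE rd; rewrite [far (far d)]farE => ->.
by rewrite farE; case xd: (crossed d); [apply: turn4 | apply: twinK].
Qed.

Lemma far_neq d : far d != d.
Proof.
rewrite farE; case: ifP => [/turn_uniq|_]; last exact: twin_neq.
by rewrite /= !inE !negb_or => /andP[/and3P[_]]; rewrite eq_sym.
Qed.

Lemma far_turn d : crossed d -> far (turn d) = turn (far d).
Proof. by move=> xd; rewrite !far_crossed ?crossed_turn. Qed.

Lemma realP d : reflect (exists v, org d = rv v) (real d).
Proof.
rewrite /real -(opd_rv_codom draw).
by apply: (iffP codomP) => -[v ->]; exists v.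
Qed.

Lemma org_turn_neq d : crossed d -> org (turn d) != org d.
Proof.
move=> xd; apply/eqP => Eorg; have := turn_uniq xd; rewrite /= inE => /andP[].
suff -> : turn d = d by rewrite eqxx.
apply: (inv_inj twinK); apply: (opd_good draw); rewrite ?org_twin_turn //.
by rewrite [twin (twin (turn d))]twinK [twin (twin d)]twinK.
Qed.

(* [g] tells on which side of the cycle [z] the face to the left of a dart
   lies. *)
Lemma cycle_potential (z : D -> bool) : dart_cycle P z ->
  exists g : D -> bool,
    [/\ forall d, g (twin d) = g d (+) z d, forall d, g (next d) = g d (+) z d
      & forall d, g (turn d) = g d (+) z (turn d)].
Proof.
have [_ /(genus_zero_cycles drawing_axioms) hom] := opd_plane draw.
move=> zc; have [g [gF zE]] := hom z zc.
have gT d : g (twin d) = g d (+) z d by rewrite zE addKb.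
have gN d : g (next d) = g d (+) z d by rewrite -gT -[d in LHS]twinK -/(face P _) gF.
exists g; split=> // d; have [zT _] := zc.
by rewrite /turn gT gN gT !zT addbK.
Qed.

End Drawing.

(** * Planarity of a set of edges no two of which cross *)

Section UncrossedPart.
Variables (V X D : finType) (E : {set {set V}}) (P : planarization X D).
Variable rv : V -> X.
Hypothesis draw : one_planar_drawing E P rv.
Variable S : {set D}.
Hypothesis S_real : forall d, d \in S -> real P d.
Hypothesis S_far : forall d, d \in S -> far P d \in S.
Hypothesis S_turn : forall d, d \in S -> crossed P d -> turn P d \notin S.
Implicit Types (d : D) (u : {d | d \in S}).

Lemma part_codom u : org P (val u) \in codom rv.
Proof. by rewrite (opd_rv_codom draw); apply: S_real (valP u). Qed.

(** Edges outside [S] are deleted from the rotations by first return, and [far] jumps over the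
    crossings, which become interior points of edges. *)
Definition part_rotation : rotation_system V {d | d \in S} :=
  RotationSystem (fun u => iinv (part_codom u))
    (fun u => exist (fun d => d \in S) _ (S_far (valP u)))
    (first_return (next_inj draw)).

Lemma rv_org_part u : rv (org part_rotation u) = org P (val u).
Proof. exact: f_iinv. Qed.

Lemma val_twin_part u : val (twin part_rotation u) = far P (val u).
Proof. by []. Qed.

Lemma part_axioms : rotation_axioms part_rotation.
Proof.
split=> [u|u||u v].
- by apply: val_inj; rewrite !val_twin_part (farK draw) // S_real ?(valP u).
- by rewrite -val_eqE val_twin_part (far_neq draw).
- exact: first_return_inj.
- by rewrite fconnect_first_return (org_orbit draw) -!rv_org_part (inj_eq (opd_rv_inj draw)).
Qed.

(** A cycle of the part lifts to a cycle of the planarization. Its face potential there, restricted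
    to [S], is a potential for the part, because it does not change across the deleted edges. *)
Lemma part_plane : plane_rotation part_rotation.
Proof.
split; first exact: part_axioms.
apply/(genus_zero_cycles part_axioms) => z [zT z0].
pose zS d := if insub d is Some u then z u else false.
have zS_val u : zS (val u) = z u by rewrite /zS valK.
have zS0 d : d \notin S -> zS d = false by move=> dS; rewrite /zS insubN.
have zS_far d : real P d -> zS (far P d) = zS d.
  move=> rd; case dS: (d \in S); last first.
    rewrite !zS0 ?dS //; apply: contraFN dS => /S_far.
    by rewrite (farK draw).
  by rewrite -[d]/(val (exist (fun d => d \in S) d dS)) -val_twin_part !zS_val zT.
(* Both segments of a crossed edge inherit the value of the edge; a dart leaving a crossing reads it
   at its real end. *)
pose zeta d := if real P d then zS d else zS (twin P d).
have zeta_cycle : dart_cycle P zeta.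
  split=> [d|x].
    rewrite /zeta; case rd: (real P d); case rTd: (real P (twin P d)) => //.
    - by rewrite -[in RHS](zS_far d) // (farE draw) /crossed ifN.
    - by rewrite (twinK draw).
    - by move/negbFE/(opd_crossed_once draw): rd rTd; rewrite /real => ->.
  (* At a crossing, opposite segments belong to one edge, so the four values cancel in pairs. *)
  case: (boolP (crossing P x)) => [xx|rx].
    have [d|] := pickP (fun d => org P d == x); last first.
      by move=> no_d; rewrite big_pred0.
    move=> /eqP Ex; subst x.
    rewrite (eq_bigl (fun e => e \in orbit (next P) d)) => [|e]; last first.
      by rewrite -fconnect_orbit (org_orbit draw) eq_sym.
    rewrite -big_uniq ?orbit_uniq //= /orbit (order_crossing draw xx) /=.
    rewrite !big_cons big_nil /zeta /real !(org_next draw) xx /=.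
    have twin_far e : crossing P (org P e) ->
        twin P (next P (next P e)) = far P (twin P e).
      by move=> xe; rewrite /far (twinK draw) xe.
    have rT : real P (twin P d) by apply: opd_crossed_once draw _ xx.
    have xN : crossing P (org P (next P d)) by rewrite (org_next draw).
    have rTN : real P (twin P (next P d)) by apply: opd_crossed_once draw _ xN.
    rewrite (twin_far d) // (twin_far (next P d)) // !zS_far //.
    by case: (zS _); case: (zS _).
  have /codomP[v Ex] : x \in codom rv by rewrite (opd_rv_codom draw).
  rewrite -[RHS](z0 v) (bigID (fun d => d \in S)) /= [X in _ (+) X]big1 ?addbF.
    rewrite (eq_bigl (fun d => (d \in S) && (org P d == x))) => [|d]; last by rewrite andbC.
    rewrite (@big_sub_cond _ _ _ _ (mem S)).
    apply: eq_big => [u|u _]; first by rewrite -(inj_eq (opd_rv_inj draw)) rv_org_part Ex.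
    by rewrite /zeta S_real ?zS_val // (valP u).
  by move=> d /andP[/eqP Ed dS]; rewrite /zeta /real Ed rx zS0.
have [g [gT gN gturn]] := cycle_potential draw zeta_cycle.
exists (fun u => g (val u)).
have zetaS d : d \in S -> zeta d = zS d by move=> dS; rewrite /zeta S_real.
(* To pass from one end of a crossed edge to the other takes two turns around the crossing; the
   first is over the crossing edge, which is not in [S] and has value zero. *)
have g_far u : g (far P (val u)) = g (val u) (+) z u.
  rewrite (farE draw); case: ifP => xd; last first.
    by rewrite gT zetaS ?zS_val // (valP u).
  have rd := S_real (valP u).
  have z_turn : zeta (turn P (val u)) = false.
    rewrite /zeta (crossed_real draw) ?(crossed_turn draw) // zS0 // S_turn //.
    exact: valP u.
  have z_far : zeta (far P (val u)) = z u.
    by rewrite zetaS ?S_far ?(valP u) // zS_far // zS_val.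
  by rewrite !gturn z_turn addbF -(far_crossed draw xd) z_far.
(* The darts skipped by the first return lie outside [S] and do not change the potential. *)
have g_next u : g (val (next part_rotation u)) = g (val u) (+) z u.
  rewrite /= /first_return /=; have := @return_time_min _ _ _ (next_inj draw) u.
  elim: return_time => [_|k IHk k_min] /=.
    by rewrite gN zetaS ?zS_val // (valP u).
  rewrite gN -/(iter k.+1 (next P) (val u)) IHk; last first.
    by move=> j lt_j; apply: k_min; rewrite ltnS ltnW.
  rewrite /zeta zS0 ?k_min // /real.
  suff -> : org P (iter k.+1 (next P) (val u)) = org P (val u).
    by rewrite -/(real P (val u)) S_real ?addbF // (valP u).
  by elim: k {IHk k_min} => [|k IHk]; rewrite iterS (org_next draw).
split=> u; last by rewrite val_twin_part g_far addKb.
by rewrite /face g_next val_twin_part g_far zT addbK.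
Qed.

Theorem part_planar (A : {set {set V}}) :
  (forall v w : V, #|[set d in S | (org P d == rv v) && (org P (far P d) == rv w)]|
     = ([set v; w] \in A)) -> planar A.
Proof.
move=> AS; exists {d | d \in S}, part_rotation; split; first exact: part_plane.
move=> v w; rewrite -AS.
rewrite -(card_imset _ val_inj); apply: eq_card => d.
apply/imsetP/idP=> [[u + ->]|]; rewrite !inE.
  by rewrite -!(inj_eq (opd_rv_inj draw)) !rv_org_part (valP u).
case/andP=> dS Ed; exists (exist (fun d => d \in S) d dS); rewrite ?inE //.
by rewrite -!(inj_eq (opd_rv_inj draw)) !rv_org_part.
Qed.

End UncrossedPart.

(** * A linear bound on the number of darts of a simple plane graph *)

Section SimplePlane.
Variables (V D : finType) (R : rotation_system V D).
Hypothesis plane : plane_rotation R.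
Hypothesis no_loop : forall d, org R (twin R d) != org R d.
Hypothesis no_multi : forall d d', org R d = org R d' ->
  org R (twin R d) = org R (twin R d') -> d = d'.

Lemma sum_order (T : finType) (f : T -> T) : injective f ->
  \sum_(x in froots f) order f x = #|T|.
Proof.
move=> f_inj; have fsym := fconnect_sym f_inj.
rewrite -[RHS]sum1_card [RHS](partition_big (froot f) (fun x => x \in froots f)) /=; last first.
  by move=> x _; apply: roots_root.
apply: eq_bigr => x rx; rewrite /order -sum1_card; apply: eq_bigl => y.
by rewrite /= -{2}(eqP rx) root_connect // fsym !inE.
Qed.

(* Weak, but it suffices: a face walk of length two is a whole component, which
   consists of one edge. *)
Lemma simple_plane_bound : #|D| <= 8 * #|V|.
Proof.
have [[twinK twin_neq next_inj org_orbit] euler] := plane.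
have org_next d : org R (next R d) = org R d.
  by apply/esym/eqP; rewrite -org_orbit fconnect1.
have le_V : fcard (next R) predT <= #|V|.
  rewrite /n_comp_mem -(card_in_image (f := org R)) ?max_card // => d d'.
  rewrite !inE !andbT => /eqP rd /eqP rd' Ed.
  rewrite -rd -rd'; apply/(rootP (fconnect_sym next_inj)).
  by rewrite org_orbit Ed.
have twin2 : fcard (twin R) predT * 2 = #|D|.
  apply: (fcard_order_set (inv_inj twinK)) => //.
  apply/subsetP => d _; rewrite unfold_in /=.
  rewrite /order (eq_card (twin_connect plane.1 d)).
  by rewrite (card2 d) (eq_sym d) twin_neq.
(* The fixed points of [next] are the darts alone at their vertex, at most one for each vertex. *)
have le_fix : #|[set d | next R d == d]| <= #|V|.
  rewrite -(card_in_imset (f := org R)) ?max_card // => d d'.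
  rewrite !inE => /eqP fd /eqP fd' Ed.
  have : fconnect (next R) d d' by rewrite org_orbit Ed.
  by case/iter_findex; rewrite iter_fix.
have f_inj := face_inj plane.1.
have le_F : 3 * fcard (face R) predT <= #|D| + #|[set d | next R d == d]|.
  rewrite -(sum_order f_inj) mulnC -sum_nat_const.
  rewrite (eq_bigl (mem (froots (face R)))) => [|d]; last by rewrite !inE andbT.
  apply: (@leq_trans (\sum_(d in froots (face R)) (order (face R) d + (next R d == d)))).
    apply: leq_sum => d _.
    have := iter_order f_inj d; have := order_gt0 (face R) d.
    case: (order _ _) => [//|[_ /= Ed|[_ /= Ed|n _ _]]]; last by lia.
      by have := no_loop d; rewrite -{2}Ed /face org_next eqxx.
    suff -> : next R d == d by [].
    have Ef : face R d = twin R d.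
      apply: no_multi; first by rewrite /face org_next.
      by rewrite twinK -{2}Ed {2}/face org_next.
    by rewrite -{2}Ed Ef /face twinK.
  rewrite big_split leq_add2l /= -sum1dep_card big_mkcond [leqRHS]big_mkcond /=.
  by apply: leq_sum => d _; case: (d \in _) => //; case: eqP.
(* Half of [#|D|] is at most the number of vertices plus that of faces, thus at most
   [#|V| + (#|D| + #|V|) / 3]; this gives the factor 8. *)
move: euler; rewrite /genus_zero; lia.
Qed.
End SimplePlane.

(** * Diagonals of crossings *)

(** A long cycle of the larger graph must use the new edge. Rotated so as to start with this edge,
    the rest of the cycle is a path in [E] joining the two ends. *)
Lemma forest_add (V : finType) (E : {set {set V}}) u v :
  forest E -> ~~ connect (adj E) u v -> forest ([set u; v] |: E).
Proof.
move=> forestE not_uv s /andP[cyc_s uniq_s]; rewrite leqNgt; apply/negP => s_gt2.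
have adjC (A : {set {set V}}) x y : adj A x y = adj A y x by rewrite /adj setUC.
have [/forallP all_next|] := boolP [forall x in s, adj E x (path.next s x)].
  have cycE : cycle (adj E) s.
    by apply: cycle_from_next => // x xs; apply: (implyP (all_next x)).
  by have := forestE s; rewrite /ucycle cycE uniq_s leqNgt s_gt2 => /(_ isT).
case/forallPn=> x; rewrite negb_imply => /andP[xs not_x].
have := next_cycle cyc_s xs; rewrite {1}/adj in_setU1 -/(adj E _ _) (negPf not_x) orbF.
set y := path.next s x => /eqP Exy.
have [i p Es] := rot_to xs.
have uniq_p : uniq (x :: p) by rewrite -Es rot_uniq.
have cyc_p : cycle (adj ([set u; v] |: E)) (x :: p) by rewrite -Es rot_cycle.
have size_p : 1 < size p by move: s_gt2; rewrite -(size_rot i) Es.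
have Ey : y = head x p.
  by rewrite /y -(next_rot i) // Es /=; case: (p) size_p => //= a p' _; rewrite eqxx.
move: uniq_p cyc_p size_p Ey {Es}; case: p => [//|a p].
rewrite [head _ _]/= => uniq_p cyc_p size_p Ea; rewrite /= -{a}Ea in uniq_p cyc_p size_p.
rewrite rcons_path in cyc_p; case/and3P: cyc_p => _ path_p last_p.
case/and3P: uniq_p; rewrite in_cons negb_or => /andP[neq_xy x_p] y_p uniq_p.
have adjE a b : a != x -> b != x -> adj ([set u; v] |: E) a b -> adj E a b.
  move=> ax bx; rewrite {1}/adj in_setU1 -Exy => /predU1P[Eab|//].
  have := set21 x y; rewrite -Eab !inE => /orP[] /eqP Ex; first by rewrite Ex eqxx in ax.
  by rewrite Ex eqxx in bx.
have path_E : path (adj E) y p.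
  apply: (sub_in_path (P := [pred z | z != x])) path_p => [a b|]; first exact: adjE.
  rewrite /= eq_sym neq_xy; apply/allP => z zp /=.
  by apply: contraNneq x_p => <-.
(* The closing edge is not the new edge run backwards: the cycle has length at least three, so its
   last vertex differs from [y]. *)
have last_E : adj E (last y p) x.
  move: last_p; rewrite {1}/adj in_setU1 -Exy => /predU1P[Eab|//].
  move: size_p y_p x_p Eab {path_p path_E uniq_p}; case/lastP: p => [//|p z].
  rewrite last_rcons => _ y_p x_p Eab.
  have := set22 x y; rewrite -Eab !inE => /orP[] /eqP Ey.
    by rewrite Ey mem_rcons mem_head in y_p.
  by rewrite Ey eqxx in neq_xy.
have con_yx : connect (adj E) y x.
  by apply/connectP; exists (rcons p x); rewrite ?rcons_path ?path_E ?last_rcons.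
case/negP: not_uv.
have con_xy : connect (adj E) x y by rewrite (sym_connect_sym (adjC E)).
by have := set21 u v; have := set22 u v; rewrite -Exy !inE => /orP[] /eqP-> /orP[] /eqP->;
  rewrite ?connect0.
Qed.

(** * Chains, components and the obstruction at a crossing *)

Section Diagonals.
Variables (V X D : finType) (E : {set {set V}}) (P : planarization X D).
Variable rv : V -> X.
Hypothesis draw : one_planar_drawing E P rv.
Implicit Types (d e : D) (x y : X) (F S : {set D}).

Local Notation org := (org P).
Local Notation twin := (twin P).
Local Notation next := (next P).
Local Notation turn := (turn P).
Local Notation far := (far P).
Local Notation real := (real P).
Local Notation crossed := (crossed P).

(** A chain modulo two with boundary [x + y], supported on the segments which have at least one of
    their two darts in [S]. Unlike walks, chains can be added without care for repetitions. *)
Definition chain S x y := exists z : D -> bool,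
  [/\ forall d, z (twin d) = z d, forall d, d \notin S -> twin d \notin S -> z d = false
    & forall w, \big[addb/false]_(d | org d == w) z d = (w == x) (+) (w == y)].

Lemma chain0 S x : chain S x x.
Proof. by exists (fun _ => false); split=> // w; rewrite addbb big1. Qed.

Lemma chain_trans S x y z : chain S x y -> chain S y z -> chain S x z.
Proof.
case=> [z1 [T1 S1 B1]] [z2 [T2 S2 B2]]; exists (fun d => z1 d (+) z2 d).
split=> [d|d dS TdS|w]; first by rewrite T1 T2.
  by rewrite S1 ?S2.
by rewrite big_split /= B1 B2 -addbA addKb.
Qed.

Lemma chain_sym S x y : chain S x y -> chain S y x.
Proof. by case=> z [T1 S1 B1]; exists z; split=> // w; rewrite B1 addbC. Qed.

Lemma sum_dart d x : \big[addb/false]_(e | org e == x) (e == d) = (x == org d).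
Proof.
have [->|neq_x] := eqVneq x (org d).
  by rewrite (bigD1 d) //= eqxx big1 // => e /andP[_ /negPf].
by rewrite big1 // => e /eqP Ee; apply: contraNF neq_x => /eqP <-; rewrite Ee.
Qed.

Lemma chain_dart S d : d \in S -> chain S (org d) (org (twin d)).
Proof.
move=> dS; exists (fun e => (e == d) (+) (e == twin d)); split=> [e|e eS TeS|w].
- by rewrite addbC (inj_eq (inv_inj (twinK draw))) (can2_eq (twinK draw) (twinK draw)).
- rewrite (_ : e == d = false); last by apply: contraNF eS => /eqP->.
  by apply: contraNF TeS => /eqP->; rewrite (twinK draw).
by rewrite big_split /= !sum_dart.
Qed.

Definition conn F : rel X :=
  connect (fun x y => [exists d in F, (org d == x) && (org (far d) == y)]).

Definition side : rel X := fun x y => [exists d, crossed d &&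
  ((org d == x) && (org (turn d) == y) || (org d == y) && (org (turn d) == x))].

(** The obstacle to adding an edge from [x] to [y]: their components coincide (case [s == t]) or are
    linked by a side. *)
Definition joined F : rel X := fun x y => [exists s, exists t,
  [&& conn F x s, conn F t y & (s == t) || side s t]].

Lemma conn_dart F d : d \in F -> conn F (org d) (org (far d)).
Proof. by move=> dF; apply/connect1/existsP; exists d; rewrite dF !eqxx. Qed.

Lemma conn_trans F x y z : conn F x y -> conn F y z -> conn F x z.
Proof. exact: connect_trans. Qed.

Lemma sub_conn F F' x y : F \subset F' -> conn F x y -> conn F' x y.
Proof.
move=> /subsetP sF; apply: connect_sub => {}x {}y /exists_inP[d dF /andP[/eqP<- /eqP<-]].
exact/conn_dart/sF.
Qed.

Lemma sub_joined F F' x y : F \subset F' -> joined F x y -> joined F' x y.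
Proof.
move=> sF /existsP[s /existsP[t /and3P[xs ty st]]]; apply/existsP; exists s.
by apply/existsP; exists t; rewrite !(sub_conn sF).
Qed.

Lemma side_turn d : crossed d -> side (org d) (org (turn d)).
Proof. by move=> xd; apply/existsP; exists d; rewrite xd !eqxx. Qed.

Lemma sideC x y : side x y = side y x.
Proof. by apply: eq_existsb => d; rewrite orbC. Qed.

Definition drawn S : {set {set V}} := [set e | [exists u, exists v, (e == [set u; v]) &&
  [exists d in S, (org d == rv u) && (org (far d) == rv v)]]].

(** A crossed edge is a diagonal of the quadrangle formed by the four ends at its crossing. Given
    closure under [far], the last field says that at most one of the two diagonals is taken. *)
Record diagonals F : Prop := {
  diagonals_crossed : forall d, d \in F -> crossed d;
  diagonals_far : forall d, d \in F -> far d \in F;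
  diagonals_turn : forall d, d \in F -> turn d \notin F
}.

Definition no_side_conn F := forall d, crossed d -> ~~ conn F (org d) (org (turn d)).

Lemma diagonals_farE F d : diagonals F -> crossed d -> (far d \in F) = (d \in F).
Proof.
move=> diagF xd; apply/idP/idP => /(diagonals_far diagF) //.
by rewrite (farK draw) // (crossed_real draw).
Qed.

Lemma conn_sym F : diagonals F -> connect_sym
  (fun x y => [exists d in F, (org d == x) && (org (far d) == y)]).
Proof.
move=> diagF; apply: sym_connect_sym => x y.
apply/exists_inP/exists_inP => -[d dF /andP[/eqP <- /eqP <-]];
  exists (far d); rewrite ?(diagonals_far diagF) // (farK draw) ?eqxx //;
  exact/(crossed_real draw)/(diagonals_crossed diagF).
Qed.


Section Separation.
Variables (F S : {set D}) (d : D) (C : {pred X}).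
Hypothesis diagF : diagonals F.
Hypothesis xd : crossed d.
Hypothesis unused_d : d \notin F.
Hypothesis unused_turn : turn d \notin F.
Hypothesis S_crossed : forall f, f \in S -> crossed f.
Hypothesis S_org : forall f, f \in S -> org f \notin C.
Hypothesis S_turn : forall f, f \in F -> org f \in C -> turn f \notin S.
Hypothesis S_unused : far d \notin S.
Hypothesis chain_S : chain S (org d) (org (far d)).
Hypothesis C_real : forall x, x \in C -> ~~ crossing P x.
Hypothesis C_conn : forall x y, x \in C -> conn F x y -> y \in C.
Hypothesis C_d : org d \notin C.
Hypothesis C_far : org (far d) \notin C.

(* Closing the chain along the edge of [d] gives a closed curve which avoids
   [C], so that all darts at vertices of [C] in one component of [F] are on
   the same side, and so are the ends in [C] of a side. *)
Lemma separation : exists g : D -> bool,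
  [/\ forall a b, conn F (org a) (org b) -> org a \in C -> g a = g b,
      forall e, org (turn e) \in C -> g (turn e) = g e
    & g (turn d) != g (far d)].
Proof.
have xf : crossed (far d) by rewrite (crossed_far draw).
have [z [zT zS z_sum]] := chain_S.
(* The chain is closed up by the two segments of the edge of [d], that is, by four darts. *)
pose z' e := z e (+) ((e == d) (+) (e == twin d) (+) ((e == far d) (+) (e == twin (far d)))).
have org_Tfar : org (twin (far d)) = org (twin d).
  by rewrite (far_crossed draw xd) !(org_twin_turn draw).
have cyc : dart_cycle P z'.
  split=> [e|w].
    rewrite /z' zT (can2_eq (twinK draw) (twinK draw)) (inj_eq (inv_inj (twinK draw))).
    rewrite (can2_eq (twinK draw) (twinK draw)) (inj_eq (inv_inj (twinK draw))).
    by rewrite [(e == twin d) (+) _]addbC [(e == twin (far d)) (+) _]addbC.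
  rewrite !big_split /= z_sum !sum_dart org_Tfar.
  by case: (w == org d); case: (w == org (far d)); case: (w == org (twin d)).
(* Seen from real vertices outside [S], the curve consists of the two ends of the closing edge
   only. *)
have z_real e : real e -> e \notin S -> z' e = (e == d) (+) (e == far d).
  move=> re eS; have TeS : twin e \notin S.
    by apply: contraL re => /S_crossed; rewrite /real negbK /crossed (twinK draw).
  have neT f : crossed f -> (e == twin f) = false.
    by move=> xf'; apply: contraTF re => /eqP->; rewrite /real negbK.
  by rewrite /z' zS // !neT // !addbF.
have z_C e : org e \in C -> z' e = false.
  move=> Ce; have re : real e by apply: C_real.
  rewrite z_real //; last by apply: contraL Ce => /S_org.
  have -> : e == d = false by apply: contraTF Ce => /eqP->.
  by apply: contraTF Ce => /eqP->.
have [g [gT gN gturn]] := cycle_potential draw cyc.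
have g_vertex a b : org a = org b -> org a \in C -> g a = g b.
  move=> /eqP; rewrite -(org_orbit draw) => /iter_findex <-.
  elim: findex => //= n IHn Ca; rewrite gN z_C ?addbF -?IHn //.
  by rewrite (_ : org _ = org a) // {IHn}; elim: n => //= n IHn; rewrite (org_next draw).
exists g; split=> [a b /connectP[p]|e Ce|]; last 1 first.
(* The darts [turn d] and [far d] follow each other around the crossing, and the curve runs along
   [far d]. *)
- have -> : g (far d) = g (turn d) (+) z' (far d) by rewrite (far_crossed draw xd) gturn.
  rewrite z_real ?(crossed_real draw) // eqxx (negPf (far_neq draw _)).
  by case: (g _).
- elim: p a => [|x p IHp] a /= => [_ /esym Eab Ca|]; first exact: g_vertex.
  case/andP=> /exists_inP[f fF /andP[/eqP Ef /eqP Ex]]; subst x => pth_p Eb Ca.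
  have Cf : org f \in C by rewrite Ef.
  have Cff : org (far f) \in C by apply: C_conn (conn_dart fF).
  have xf' := diagonals_crossed diagF fF.
  rewrite -(IHp (far f)) // -(g_vertex f a) // [far f](far_crossed draw xf') !gturn.
  rewrite -(far_crossed draw xf') (z_C (far f)) // addbF.
  rewrite z_real ?(crossed_real draw) ?(crossed_turn draw) ?S_turn //.
  rewrite (far_crossed draw xd) (inj_eq (turn_inj draw)).
  have -> : turn f == d = false.
    apply: contraNF unused_turn => /eqP <-.
    by rewrite -(far_crossed draw xf') (diagonals_far diagF).
  have -> : f == turn d = false by apply: contraNF unused_turn => /eqP <-.
  by case: (g f).
- by rewrite gturn z_C ?addbF.
Qed.
End Separation.

(** Each edge on the way contributes its two segments, which meet at its crossing. Only edges in the
    component of [x] are used, so [S] may omit the rest of [F]. *)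
Lemma conn_chain F S x y : diagonals F ->
  {in F, forall f, conn F x (org f) -> f \in S} -> conn F x y -> chain S x y.
Proof.
move=> diagF FS /connectP[p]; elim/last_ind: p y => [|p z IHp] y /=.
  by move=> _ ->; apply: chain0.
rewrite rcons_path last_rcons => /andP[pth_p /exists_inP[f fF /andP[/eqP Ef /eqP Ez]]] Ey.
subst y z; have xf : conn F x (org f) by apply/connectP; exists p.
apply: chain_trans (IHp _ pth_p Ef) _.
apply: chain_trans (chain_dart (FS f fF xf)) _; apply: chain_sym.
have -> : org (twin f) = org (twin (far f)).
  by rewrite (far_crossed draw) ?(org_twin_turn draw) // (diagonals_crossed diagF).
apply/chain_dart/FS; first exact: diagonals_far.
exact: connect_trans xf (conn_dart fF).
Qed.

Lemma conn_real F x y : diagonals F -> ~~ crossing P x -> conn F x y -> ~~ crossing P y.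
Proof.
move=> diagF rx /connectP[p]; elim: p x rx => [|z p IHp] x rx /=; first by move=> _ ->.
case/andP=> /exists_inP[f fF /andP[_ /eqP <-]]; apply: IHp.
by apply: (real_far draw); apply/(crossed_real draw)/(diagonals_crossed diagF).
Qed.

(** The first obstacle closes the edge of [d] to a curve inside the components [C1] of its ends. By
    [separation], the ends of the other edge lie on different sides of this curve. The second
    obstacle connects these ends through the components [C2], across which the potential is
    constant. *)
Lemma joined_crossing F d : diagonals F -> no_side_conn F -> crossed d ->
    d \notin F -> turn d \notin F -> joined F (org d) (org (far d)) ->
  ~~ joined F (org (turn d)) (org (turn (far d))).
Proof.
move=> diagF no_side xd dF tdF /existsP[s /existsP[t /and3P[conn_s conn_t st]]].
apply/negP=> /existsP[s' /existsP[t' /and3P[conn_s' conn_t' st']]].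
have symF := conn_sym diagF.
pose C1 := [pred x | conn F (org d) x || conn F (org (far d)) x].
pose C2 := [pred x | conn F (org (turn d)) x || conn F (org (turn (far d))) x].
have xf : crossed (far d) by rewrite (crossed_far draw).
have xt : crossed (turn d) by rewrite (crossed_turn draw).
have xtf : crossed (turn (far d)) by rewrite (crossed_turn draw).
have Eft : far d = turn (turn d) by rewrite (far_crossed draw).
have Ed : d = turn (turn (far d)) by rewrite Eft (turn4 draw).
(* Each end of one edge forms a side with each end of the other, and sides do not join a component
   to itself. *)
have disj x : x \in C1 -> x \notin C2.
  move=> C1x; apply/norP; split; apply/negP => C2x; case/orP: C1x => C1x.
  - by case/negP: (no_side d xd); apply: connect_trans C1x _; rewrite symF.
  - case/negP: (no_side _ xt); rewrite -Eft.
    by apply: connect_trans C2x _; rewrite symF.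
  - case/negP: (no_side _ xtf); rewrite -Ed.
    by apply: connect_trans C2x _; rewrite symF.
  - by case/negP: (no_side _ xf); apply: connect_trans C1x _; rewrite symF.
have C1_conn x y : x \in C1 -> conn F x y -> y \in C1.
  by move=> /orP[] xx xy; apply/orP; [left|right]; apply: connect_trans xx xy.
have C2_conn x y : x \in C2 -> conn F x y -> y \in C2.
  by move=> /orP[] xx xy; apply/orP; [left|right]; apply: connect_trans xx xy.
have C2_real x : x \in C2 -> ~~ crossing P x.
  by case/orP; apply: conn_real => //; apply: (crossed_real draw).
have C1d : org d \in C1 by rewrite inE /= /conn connect0.
have C1f : org (far d) \in C1 by rewrite inE /= /conn connect0 orbT.
have C1s : s \in C1 by apply: C1_conn conn_s.
have C1t : t \in C1 by apply: (C1_conn (org (far d))) => //; rewrite /conn symF.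
have C2d : org (turn d) \in C2 by rewrite inE /= /conn connect0.
have C2f : org (turn (far d)) \in C2 by rewrite inE /= /conn connect0 orbT.
have C2s : s' \in C2 by apply: C2_conn conn_s'.
have C2t : t' \in C2 by apply: (C2_conn (org (turn (far d)))) => //; rewrite /conn symF.
pose S0 := [set f in F | org f \in C1].
(* [S] carries the first curve: the edges of [F] in [C1] and, if a side is needed, the two
   half-edges from its ends to its crossing. *)
have [S [S0S S_spec chain_st]] : exists S : {set D}, [/\ S0 \subset S,
    forall f, f \in S -> f \in S0 \/ exists e, [/\ crossed e, org e \in C1,
      org (turn e) \in C1 & f = e \/ f = turn e]
    & chain S s t].
  case: eqVneq st => [<- _|_ /= /existsP[e /andP[xe Ee]]].
    by exists S0; split=> // [f|]; [left | apply: chain0].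
  have [C1e C1te] : org e \in C1 /\ org (turn e) \in C1.
    by case/orP: Ee => /andP[/eqP-> /eqP->].
  exists (e |: (turn e |: S0)); split=> [|f|].
  - by apply/subsetP => f fS; rewrite !in_setU1 fS !orbT.
  - case/setU1P=> [->|/setU1P[->|fS]]; last by left.
      by right; exists e; split=> //; left.
    by right; exists e; split=> //; right.
  suff chain_e : chain (e |: (turn e |: S0)) (org e) (org (turn e)).
    by case/orP: Ee => /andP[/eqP <- /eqP <-] //; apply: chain_sym.
  apply: chain_trans (chain_dart (setU11 _ _)) _.
  rewrite -(org_twin_turn draw); apply/chain_sym/chain_dart.
  by rewrite in_setU1 setU11 orbT.
have FS f : f \in F -> org f \in C1 -> f \in S.
  by move=> fF Cf; apply: (subsetP S0S); rewrite inE fF.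
have turn_turn e : crossed e -> turn (turn e) = far e by move/(far_crossed draw).
have [g [g_conn g_side /eqP[]]] : exists g : D -> bool,
  [/\ forall a b, conn F (org a) (org b) -> org a \in C2 -> g a = g b,
      forall e, org (turn e) \in C2 -> g (turn e) = g e
    & g (turn d) != g (far d)].
  apply: (@separation F S) => //.
  - move=> f /S_spec[|[e [xe _ _ [->|->]]]]; rewrite ?(crossed_turn draw) //.
    by rewrite inE => /andP[/(diagonals_crossed diagF)].
  - move=> f /S_spec[|[e [xe Ce Cte [->|->]]]]; try exact: disj.
    by rewrite inE => /andP[_ /disj].
  - move=> f fF Cf; apply/negP=> /S_spec[|[e [xe Ce Cte [Ee|/(turn_inj draw) Ee]]]].
    + by rewrite inE => /andP[tfF _]; move: (diagonals_turn diagF fF); rewrite tfF.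
    + move/disj/negP: Cte; rewrite -Ee turn_turn ?(diagonals_crossed diagF) //.
      by apply; apply: C2_conn (conn_dart fF).
    by move/disj/negP: Ce; rewrite -Ee.
  (* The side used cannot be one at the crossing of [d], since such a side has an end in [C2]. So
     the closing edge is not cancelled. *)
  - apply/negP=> /S_spec[|[e [xe Ce Cte [Ee|]]]].
    + by rewrite inE (diagonals_farE diagF) // (negPf dF).
    + by move/disj/negP: Cte; rewrite -Ee.
    by rewrite Eft => /(turn_inj draw) Ee; move/disj/negP: Ce; rewrite -Ee.
  - apply: chain_trans (chain_trans chain_st _).
      apply: (@conn_chain F) => // f fF df; apply: FS => //.
      exact: C1_conn df.
    apply: (@conn_chain F) => // f fF df; apply: FS => //.
    by apply: C1_conn df.
  - exact: disj.
  - exact: disj.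
(* The corner between [far d] and [turn (far d)] is not cut by the curve, so it remains to carry [g]
   from one end of the other edge to the other end. *)
have -> : g (far d) = g (turn (far d)) by rewrite -g_side.
case: eqVneq st' => [Es _|_ /= /existsP[e /andP[xe Ee]]].
  by apply: g_conn => //; apply: connect_trans conn_s' _; rewrite Es.
case/orP: Ee => /andP[/eqP Es /eqP Et].
  transitivity (g e); first by apply: g_conn => //; rewrite Es.
  rewrite -g_side ?Et //; apply: g_conn; rewrite ?Et //.
transitivity (g (turn e)); first by apply: g_conn => //; rewrite Et.
by rewrite g_side ?Et //; apply: g_conn; rewrite ?Es //.
Qed.

Definition add_diagonal F d := d |: (far d |: F).

Lemma sub_add_diagonal F d : F \subset add_diagonal F d.
Proof. by apply/subsetP => f fF; rewrite !in_setU1 fF !orbT. Qed.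

Lemma conn_add_diagonal F d x y : real d -> conn (add_diagonal F d) x y ->
  [\/ conn F x y, conn F x (org d) /\ conn F (org (far d)) y
    | conn F x (org (far d)) /\ conn F (org d) y].
Proof.
move=> rd /connectP[p]; elim: p x => [|z p IHp] x /=.
  by move=> _ ->; constructor 1; apply: connect0.
case/andP=> /exists_inP[f fF /andP[/eqP <- /eqP Ez]] /IHp{}IHp Ey.
have := IHp Ey; rewrite -{}Ez; case/setU1P: fF => [->|/setU1P[->|/conn_dart fF]].
- by case=> [?|[_ ?]|[_ ?]];
    [constructor 2|constructor 2|constructor 1]; rewrite /conn ?connect0.
- rewrite (farK draw) //; case=> [?|[_ ?]|[_ ?]];
    by [constructor 3; rewrite /conn ?connect0 | constructor 1
       |constructor 3; rewrite /conn ?connect0].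
case=> [fy|[fd dy]|[fd dy]]; [constructor 1|constructor 2|constructor 3];
  rewrite /conn; try split=> //; exact: connect_trans fF _.
Qed.

Record tree_like F : Prop := {
  tree_diagonals : diagonals F;
  tree_no_side : no_side_conn F;
  tree_forest : forest (drawn F)
}.

Lemma drawn_conn F u v : connect (adj (drawn F)) u v -> diagonals F -> conn F (rv u) (rv v).
Proof.
move=> uv diagF; case/connectP: uv => p; elim: p u => [|w p IHp] u /=.
  by move=> _ ->; apply: connect0.
case/andP=> + pth_p Ev; rewrite /adj inE => /existsP[a /existsP[b /andP[/eqP Eab]]].
case/exists_inP=> f fF /andP[/eqP Ea /eqP Eb].
apply: connect_trans (IHp w pth_p Ev).
have ab : conn F (rv a) (rv b) by rewrite -Ea -Eb conn_dart.
have ba : conn F (rv b) (rv a) by rewrite /conn conn_sym.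
have := set21 u w; have := set22 u w; rewrite Eab !inE => /orP[] /eqP-> /orP[] /eqP->;
  rewrite -/(conn _ _ _) /conn ?connect0 //.
Qed.

Lemma tree_like0 : tree_like set0.
Proof.
split; first by split=> d; rewrite inE.
  move=> d xd; apply/negP=> /connectP[[|y p] /= pth_p Ed].
    by case/eqP: (org_turn_neq draw xd).
  by case/andP: pth_p => /exists_inP[f]; rewrite inE.
move=> [|u [|v s]] // /andP[/= /andP[+ _] _].
rewrite /adj inE => /existsP[a /existsP[b /andP[_ /exists_inP[f]]]].
by rewrite inE.
Qed.

(** A side inside a component of the larger set would link the two components merged by the new
    edge, which is an obstacle in the sense of [joined]. *)
Lemma tree_like_add F d : tree_like F -> crossed d -> d \notin F -> turn d \notin F ->
  ~~ joined F (org d) (org (far d)) -> tree_like (add_diagonal F d).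
Proof.
case=> diagF no_side forF xd dF tdF not_joined.
have rd := crossed_real draw xd; have xf : crossed (far d) by rewrite (crossed_far draw).
have Eft := far_crossed draw xd.
have not_conn : ~~ conn F (org d) (org (far d)).
  apply: contra not_joined => df; apply/existsP; exists (org d); apply/existsP.
  by exists (org d); rewrite eqxx df /conn connect0.
have tfdF : turn (far d) \notin F.
  by rewrite -(far_turn draw xd) (diagonals_farE diagF) ?(crossed_turn draw).
have fdF : far d \notin F by rewrite (diagonals_farE diagF).
have diagF' : diagonals (add_diagonal F d).
  split=> f.
  - by case/setU1P=> [->|/setU1P[->|/(diagonals_crossed diagF)]].
  - case/setU1P=> [->|/setU1P[->|/(diagonals_far diagF) fF]].
    + by rewrite in_setU1 setU11 orbT.
    + by rewrite (farK draw) // setU11.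
    by rewrite !in_setU1 fF !orbT.
  have [neq1 neq3 neq4 neq6] :
      [/\ d != turn d, d != turn (far d), turn d != far d & far d != turn (far d)].
    have := turn_uniq draw xd; rewrite -Eft /= !inE !negb_or.
    by case/andP=> /and3P[-> _ ->] /andP[/andP[-> _] /andP[-> _]].
  rewrite !in_setU1 !negb_or; case/or3P=> [/eqP->|/eqP->|fF].
  - by rewrite eq_sym neq1 neq4 tdF.
  - by rewrite eq_sym neq3 eq_sym neq6 tfdF.
  rewrite (diagonals_turn diagF fF) andbT; apply/andP; split.
    apply: contraNneq tfdF => Ef; suff -> : turn (far d) = f by [].
    by apply: (turn_inj draw); rewrite Ef Eft (turn4 draw).
  apply: contraNneq tdF => Ef; suff -> : turn d = f by [].
  by apply: (turn_inj draw); rewrite Ef Eft.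
split=> //.
  move=> e xe; apply/negP=> /(conn_add_diagonal rd).
  have symF := conn_sym diagF.
  case=> [|[e1 e2]|[e1 e2]]; first exact/negP/no_side.
    case/negP: not_joined; apply/existsP; exists (org e); apply/existsP.
    exists (org (turn e)); rewrite side_turn // orbT andbT /conn symF.
    by rewrite -/(conn F _ _) e1 /conn symF.
  case/negP: not_joined; apply/existsP; exists (org (turn e)); apply/existsP.
  by exists (org e); rewrite sideC side_turn // orbT andbT e1 e2.
have [u Eu] := realP draw d rd; have [v Ev] := realP draw (far d) (real_far draw rd).
have -> : drawn (add_diagonal F d) = [set u; v] |: drawn F.
  apply/setP => A; rewrite in_setU1 !inE; apply/existsP/orP.
    case=> a /existsP[b /andP[/eqP-> /exists_inP[f + /andP[/eqP Ea /eqP Eb]]]].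
    have rv_inj := opd_rv_inj draw.
    case/setU1P=> [Ef|/setU1P[Ef|fF]].
    - left; subst f; rewrite Eu in Ea; rewrite Ev in Eb.
      by rewrite (rv_inj _ _ Ea) (rv_inj _ _ Eb).
    - left; subst f; rewrite (farK draw) // Eu in Eb; rewrite Ev in Ea.
      by rewrite (rv_inj _ _ Ea) (rv_inj _ _ Eb) setUC.
    right; apply/existsP; exists a; apply/existsP; exists b; rewrite eqxx /=.
    by apply/exists_inP; exists f; rewrite // Ea Eb !eqxx.
  case=> [/eqP->|/existsP[a /existsP[b /andP[/eqP-> /exists_inP[f fF Ef]]]]].
    exists u; apply/existsP; exists v; rewrite eqxx /=; apply/exists_inP; exists d.
      exact: setU11.
    by rewrite Eu Ev !eqxx.
  exists a; apply/existsP; exists b; rewrite eqxx /=; apply/exists_inP; exists f => //.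
  exact: (subsetP (sub_add_diagonal F d)).
apply: forest_add => //; apply: contra not_conn => /drawn_conn.
by rewrite Eu Ev; apply.
Qed.

End Diagonals.

Section Completion.
Variables (V X D : finType) (E : {set {set V}}) (P : planarization X D).
Variable rv : V -> X.
Hypothesis draw : one_planar_drawing E P rv.
Implicit Types (d e : D) (x y : X) (F : {set D}).

Local Notation org := (org P).
Local Notation twin := (twin P).
Local Notation next := (next P).
Local Notation turn := (turn P).
Local Notation far := (far P).
Local Notation crossed := (crossed P).

Lemma joinedC F x y : diagonals P F -> joined P F x y -> joined P F y x.
Proof.
move=> diagF /existsP[s /existsP[t /and3P[xs ty st]]]; have symF := conn_sym draw diagF.
apply/existsP; exists t; apply/existsP; exists s.
have yt : conn P F y t by rewrite /conn symF.
have sx : conn P F s x by rewrite /conn symF.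
by rewrite yt sx eq_sym sideC.
Qed.

(* The diagonals of [T] outside [F] need not be tracked: what blocks the other
   diagonal of their crossing makes it possible to add them. *)
Lemma tree_like_complete F T : tree_like P rv F -> diagonals P T -> F \subset T ->
  (forall d, d \in T -> d \notin F -> joined P F (org (turn d)) (org (far (turn d)))) ->
  tree_like P rv T.
Proof.
move=> treeF diagT; have [n] := ubnP #|T :\: F|.
elim: n F treeF => // n IHn F treeF le_n sFT blocked.
have [diagF no_side _] := treeF.
have [T0|[d]] := set_0Vmem (T :\: F).
  suff -> : T = F by [].
  by apply/eqP; rewrite eqEsubset sFT andbT -setD_eq0 T0.
case/setDP=> dT dF; have xd := diagonals_crossed diagT dT.
have rd := crossed_real draw xd; have Eft := far_crossed draw xd.
have fdF : far d \notin F by rewrite (diagonals_farE draw diagF).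
have fdT : far d \in T by apply: (diagonals_far diagT).
have notF e : e \in T -> turn e \notin F.
  by move/(diagonals_turn diagT); apply: contra; apply: (subsetP sFT).
have xtd : crossed (turn d) by rewrite (crossed_turn draw).
(* The crossing lemma is used at [turn d], whose blocked edge is given; its other edge starts there
   with [turn (turn d) = far d]. Adding [far d] adds the same edge as adding [d]. *)
have not_joined : ~~ joined P F (org (far d)) (org (far (far d))).
  have := joined_crossing draw diagF no_side xtd; rewrite -Eft => /(_ (notF d dT) fdF).
  by rewrite -(far_turn draw xtd) -Eft; apply; apply: blocked.
have xfd : crossed (far d) by apply: crossed_far draw _ xd.
have sF1 : add_diagonal P F (far d) \subset T.
  apply/subsetP=> e; rewrite !in_setU1 (farK draw) //.
  by case/or3P=> [/eqP->|/eqP->|/(subsetP sFT)].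
apply: (IHn (add_diagonal P F (far d))) => //.
- exact: (tree_like_add draw treeF xfd fdF (notF _ fdT) not_joined).
- rewrite ltnS in le_n; apply: leq_trans le_n; apply: proper_card; apply/properP; split.
    by apply: setDS; apply: sub_add_diagonal.
  exists d; first by rewrite inE dF.
  by rewrite !inE (farK draw) // eqxx orbT.
move=> e eT eF1; apply: sub_joined (sub_add_diagonal P F (far d)) _.
apply: blocked => //; apply: contra eF1; exact: (subsetP (sub_add_diagonal P F _)).
Qed.

End Completion.

(** * The algorithm *)

Definition upd (T : eqType) (U : Type) (f : T -> U) (i : T) (v : U) : T -> U :=
  fun j => if j == i then v else f j.

(* The queue holds darts at vertices of the components of the growing forest,
   one component after the other; [lab] numbers the components, and [stamp] is
   the number of the current one.  A popped dart has marked its vertex and the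
   neighbours of this vertex along sides; a decided dart has no undecided
   crossing on its edge. *)
Record state (X D : Type) := State {
  queue : seq D; popped : nat; decided : nat; scanned : nat; stamp : nat;
  lab : D -> nat; mark : X -> nat; dec : X -> nat; out : D -> nat
}.

Section Algorithm.
Variables (X : finType) (nd : nat) (P : planarization X 'I_nd).
Implicit Types (st : state X 'I_nd) (d e : 'I_nd).

Local Notation org := (org P).
Local Notation twin := (twin P).
Local Notation next := (next P).
Local Notation turn := (turn P).
Local Notation far := (far P).
Local Notation crossed := (crossed P).

Definition init_state : state X 'I_nd :=
  State [::] 0 0 0 0 (fun=> 0) (fun=> 0) (fun=> 0) (fun=> 0).

Definition push st e :=
  State (rcons (queue st) e) (popped st) (decided st) (scanned st) (stamp st)
    (upd (lab st) e (stamp st)) (mark st) (dec st) (out st).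

Definition mark_step st d :=
  let g := stamp st in
  let m := upd (mark st) (org d) g in
  State (queue st) (popped st).+1 (decided st) (scanned st) g (lab st)
    (if crossed d then upd (upd m (org (turn d)) g) (org (turn (far d))) g else m)
    (dec st) (out st).

Definition pop_step st d :=
  mark_step (if lab st (next d) == 0 then push st (next d) else st) d.

Definition choose st d :=
  State (queue st) (popped st) (decided st) (scanned st) (stamp st) (lab st) (mark st)
    (upd (dec st) (org (twin d)) 1) (upd (upd (out st) d 1) (far d) 1).

Definition incr_decided st :=
  State (queue st) (popped st) (decided st).+1 (scanned st) (stamp st) (lab st)
    (mark st) (dec st) (out st).

Definition decide_step st d :=
  incr_decided (if crossed d && (dec st (org (twin d)) == 0) then
    if mark st (org (far d)) == stamp st then choose st (turn d)
    else push (choose st d) (far d)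
  else st).

Definition incr_stamp st :=
  State (queue st) (popped st) (decided st) (scanned st) (stamp st).+1 (lab st)
    (mark st) (dec st) (out st).

Definition incr_scanned st :=
  State (queue st) (popped st) (decided st) (scanned st).+1 (stamp st) (lab st)
    (mark st) (dec st) (out st).

Definition scan_step st d :=
  incr_scanned (if real P d && (lab st d == 0)
    then push (incr_stamp st) d else st).

(** The priorities matter: a dart is decided only when all queued darts have set their marks, and a
    new component starts only when the current one has no undecided crossing left. *)
Definition step st :=
  if ohead (drop (popped st) (queue st)) is Some d then pop_step st d
  else if ohead (drop (decided st) (queue st)) is Some d then decide_step st d
  else if insub (scanned st) is Some d then scan_step st d
  else st.

Definition running st :=
  [|| popped st < size (queue st), decided st < size (queue st) | scanned st < nd].

(** * Invariants of the search *)

Section Invariant.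
Variables (V : finType) (E : {set {set V}}) (rv : V -> X).
Hypothesis draw : one_planar_drawing E P rv.
Implicit Type F : {set 'I_nd}.

Definition nbr d : pred X :=
  [pred y | (y == org d) || crossed d && ((y == org (turn d)) || (y == org (turn (far d))))].

(** This half of the invariant does not read [dec] and [out], so it survives every choice. [gr_mark]
    makes current marks complete, [gr_marked] makes all nonzero marks sound; by [gr_current] every
    older component is entirely decided. *)
Record growing st F : Prop := {
  gr_tree : tree_like P rv F;
  gr_uniq : uniq (queue st);
  gr_real : {in queue st, forall d, real P d};
  gr_lab : forall d, (lab st d != 0) = (d \in queue st);
  gr_stamp : forall d, lab st d <= stamp st;
  gr_decided : decided st <= popped st;
  gr_popped : popped st <= size (queue st);
  gr_scanned : scanned st <= nd;
  gr_next : {in take (popped st) (queue st), forall d, lab st (next d) = lab st d};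
  gr_forest : {in F, forall d, d \in queue st /\ lab st (far d) = lab st d};
  gr_conn : forall d e, d \in queue st -> lab st d = lab st e -> conn P F (org d) (org e);
  gr_mark : {in take (popped st) (queue st), forall d, lab st d = stamp st ->
    {in nbr d, forall y, mark st y = stamp st}};
  gr_marked : forall y, mark st y != 0 ->
    exists d, [/\ d \in queue st, lab st d = mark st y & y \in nbr d];
  gr_current : {in drop (decided st) (queue st), forall d, lab st d = stamp st};
  gr_scan : forall d, real P d -> d < scanned st -> d \in queue st
}.

(** [F] contains only the chosen edges which the search follows. [ch_blocked] keeps, for each other
    chosen edge, the obstacle to its crossing partner, as needed by [tree_like_complete]. *)
Record choosing st F : Prop := {
  ch_decided : {in take (decided st) (queue st), forall d, crossed d ->
    dec st (org (twin d)) != 0};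
  ch_out : forall d, crossed d -> out st d + out st (turn d) = (dec st (org (twin d)) != 0);
  ch_far : forall d, crossed d -> out st (far d) = out st d;
  ch_uncrossed : forall d, ~~ crossed d -> out st d = 0;
  ch_forest : {in F, forall d, out st d = 1};
  ch_blocked : forall d, out st d != 0 -> d \notin F ->
    joined P F (org (turn d)) (org (far (turn d)))
}.

Lemma updE (T : eqType) (U : Type) (f : T -> U) i v j :
  upd f i v j = if j == i then v else f j.
Proof. by []. Qed.

(** Covers all three ways of queueing a dart: the next one at a vertex and the start of a component,
    both with [F1 = F], and the far end of a newly followed edge. *)
Lemma growing_push st F F1 e : growing st F ->
    F \subset F1 -> tree_like P rv F1 -> real P e -> lab st e = 0 -> 0 < stamp st ->
    (forall d, d \in queue st -> lab st d = stamp st -> conn P F1 (org d) (org e)) ->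
    (forall d, d \in F1 -> d \notin F ->
      upd (lab st) e (stamp st) d = stamp st /\ upd (lab st) e (stamp st) (far d) = stamp st) ->
  growing (push st e) F1.
Proof.
move=> [tree uq rl labE le_st le_dp le_p le_s nx fo cn mk mkd cur sc] sF tree1 re e0 st0 cne F1F.
have e_q : e \notin queue st by rewrite -labE e0.
have neq d : d \in queue st -> (d == e) = false by move=> dq; apply: contraNF e_q => /eqP<-.
have lab_q d : d \in queue st -> upd (lab st) e (stamp st) d = lab st d.
  by move=> dq; rewrite /upd neq.
have take_q d n : d \in take n (queue st) -> d \in queue st by apply: mem_take.
have take_r n : n <= size (queue st) -> take n (rcons (queue st) e) = take n (queue st).
  by move=> le_n; rewrite -cats1 takel_cat.
split=> //=.
- by rewrite rcons_uniq e_q.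
- by move=> d; rewrite mem_rcons in_cons => /predU1P[->|/rl].
- by move=> d; rewrite mem_rcons in_cons /upd; case: (eqVneq d e) => [_|_];
    [rewrite -lt0n st0 | rewrite labE].
- by move=> d; rewrite /upd; case: eqP.
- by rewrite size_rcons ltnW.
- move=> d; rewrite take_r // => /[dup] /nx dx /take_q dq; rewrite [RHS]lab_q // lab_q //.
  by rewrite -labE dx labE.
- move=> d dF1; have [dF|dF] := boolP (d \in F).
    have [dq df] := fo d dF; rewrite mem_rcons in_cons dq orbT; split=> //.
    by rewrite !lab_q // -labE df labE.
  have [ld lf] := F1F d dF1 dF; rewrite lf ld mem_rcons in_cons; split=> //.
  move: ld; rewrite /upd; case: eqP => //= _ ld.
  by rewrite -labE ld -lt0n.
- move=> d d'; rewrite mem_rcons in_cons => /predU1P[->|dq].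
    rewrite /upd eqxx; case: eqVneq => [-> _|_ Ed']; first exact: connect0.
    have d'q : d' \in queue st by rewrite -labE -Ed' -lt0n.
    by rewrite /conn (conn_sym draw (tree_diagonals tree1)); apply: cne.
  rewrite lab_q // /upd; case: eqVneq => [-> |_ Ed]; first exact: cne.
  exact: sub_conn sF (cn _ _ dq Ed).
- move=> d; rewrite take_r // => dt; have dq := take_q _ _ dt; rewrite lab_q //.
  exact: mk.
- move=> y /mkd[d [dq ld dy]]; exists d; rewrite mem_rcons in_cons dq orbT lab_q //.
- move=> d; rewrite drop_rcons ?(leq_trans le_dp) // mem_rcons in_cons.
  case/predU1P=> [->|dt]; first by rewrite /upd eqxx.
  by rewrite lab_q ?cur // (mem_drop dt).
by move=> d rd /sc dq; rewrite mem_rcons in_cons dq ?orbT.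
Qed.

(* The darts at a vertex are pushed in rotation, so an older label on one of
   them would have spread to all of them. *)
Lemma growing_next st F d : growing st F -> decided st <= popped st ->
  d \in drop (popped st) (queue st) -> lab st (next d) != 0 -> lab st (next d) = lab st d.
Proof.
move=> [tree uq rl labE le_st le_dp le_p le_s nx fo cn mk mkd cur sc] _ dd nz.
have dcur : lab st d = stamp st.
  by apply: cur; move: dd; rewrite -(subnK le_dp) -drop_drop => /mem_drop.
apply/eqP; rewrite dcur; apply: contraTT isT => old.
have old_iter n : lab st (iter n next (next d)) = lab st (next d).
  elim: n => //= n IHn; rewrite -IHn; apply: nx.
  have : iter n next (next d) \in queue st by rewrite -labE IHn.
  rewrite -{1}(cat_take_drop (decided st) (queue st)) mem_cat => /orP[|/cur E1].
    by rewrite -(subnK le_dp) addnC takeD mem_cat => ->.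
  by rewrite -IHn E1 eqxx in old.
have : fconnect next (next d) d by rewrite (fconnect_sym (next_inj draw)) fconnect1.
by move/iter_findex=> Ed; move: old; rewrite -(old_iter (findex next (next d) d)) Ed dcur eqxx.
Qed.

Lemma growing_pop st F d s : growing st F -> drop (popped st) (queue st) = d :: s ->
  growing (pop_step st d) F.
Proof.
move=> gr Ed; rewrite /pop_step.
have dd : d \in drop (popped st) (queue st) by rewrite Ed mem_head.
have dq : d \in queue st := mem_drop dd.
have ltp : popped st < size (queue st).
  by rewrite -subn_gt0 -size_drop Ed.
have dcur : lab st d = stamp st.
  by apply: (gr_current gr); move: dd; rewrite -(subnK (gr_decided gr)) -drop_drop => /mem_drop.
have st0 : 0 < stamp st by rewrite -dcur lt0n (gr_lab gr).
set st1 := if _ then _ else _.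
have [gr1 next1 Est] : [/\ growing st1 F, lab st1 (next d) = lab st1 d
    & [/\ popped st1 = popped st, stamp st1 = stamp st, lab st1 d = stamp st,
          popped st < size (queue st1) & nth d (queue st1) (popped st) = d]].
  have nthd : nth d (queue st) (popped st) = d.
    by rewrite -[popped st in LHS]addn0 -nth_drop Ed.
  rewrite /st1; case: eqP => [next0|/eqP next_nz]; last first.
    by rewrite (growing_next gr (gr_decided gr) dd).
  have ned : d == next d = false.
    by apply/eqP => Edn; move: st0; rewrite -dcur Edn next0.
  split; last by rewrite /= /upd ned size_rcons ltnW // nth_rcons ltp.
    apply: (@growing_push st F F (next d)) => //; first exact: gr_tree gr.
    - by rewrite /real (org_next draw); apply: (gr_real gr).
    - by move=> e eq Ee; rewrite (org_next draw); apply: (gr_conn gr) => //; rewrite dcur.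
    by move=> e ->.
  by rewrite /= /upd eqxx ned dcur.
case: Est => Ep Es Ed1 ltp1 nth1; case: gr1 => tree uq rl labE le_st le_dp le_p le_s nx fo cn mk mkd cur sc.
have dq1 : d \in queue st1 by rewrite -nth1 mem_nth.
have take1 : take (popped st1).+1 (queue st1) = rcons (take (popped st1) (queue st1)) d.
  by rewrite (take_nth d) Ep ?nth1.
pose mark1 := mark (mark_step st1 d).
have markE y : mark1 y = if y \in nbr d then stamp st1 else mark st1 y.
  rewrite /mark1 /= !inE; case: ifP => xd; rewrite /upd ?andTb ?andFb ?orbF //.
  by case: (y == org (turn (far d))); case: (y == org (turn d)); case: (y == org d).
split=> //=; rewrite ?take1 -/mark1.
- exact: leqW.
- by rewrite Ep.
- by move=> e; rewrite mem_rcons in_cons => /predU1P[->//|/nx].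
- move=> e; rewrite mem_rcons in_cons => /predU1P[->|et] le y ye.
    by move: (markE y); rewrite ye.
  by move: (markE y); rewrite (mk e) //; case: ifP.
- move=> y; rewrite -[if _ then _ else _]/(mark1) markE; case: ifP => yd; last exact: mkd.
  by exists d; rewrite Ed1 Es.
Qed.


Lemma choosing_pop st F d : choosing st F -> decided st <= popped st ->
  popped st < size (queue st) -> choosing (pop_step st d) F.
Proof.
move=> [dc o1 o2 o3 o4 o5] le_dp lt_p; split; rewrite /pop_step; case: ifP => _ //=.
move=> e; rewrite -cats1 takel_cat; first exact: dc.
by rewrite (leq_trans le_dp) // ltnW.
Qed.

Lemma growing_incr_decided st F : growing st F -> decided st < popped st ->
  growing (incr_decided st) F.
Proof.
move=> [tree uq rl labE le_st le_dp le_p le_s nx fo cn mk mkd cur sc] lt_dp; split=> //=.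
by move=> d; rewrite -add1n -drop_drop => /mem_drop; apply: cur.
Qed.

Lemma growing_choose st F d : growing st F -> growing (choose st d) F.
Proof. by case=> *; split. Qed.

Lemma growing_vertex st F d e : growing st F -> popped st = size (queue st) ->
  d \in queue st -> org d = org e -> lab st e = lab st d.
Proof.
move=> gr Ep dq /eqP; rewrite -(org_orbit draw) => /iter_findex <-.
have nx : {in queue st, forall d, lab st (next d) = lab st d}.
  by have := gr_next gr; rewrite Ep take_size.
elim: findex => //= n IHn; rewrite nx // -(gr_lab gr) IHn (gr_lab gr) //.
Qed.

Lemma nbr_side d y : y \in nbr d -> (org d == y) || side P (org d) y.
Proof.
rewrite !inE => /orP[/eqP->|/andP[xd]]; first by rewrite eqxx.
case/orP=> /eqP->; first by rewrite side_turn ?orbT.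
rewrite sideC; have xt : crossed (turn (far d)) by rewrite (crossed_turn draw) (crossed_far draw).
apply/orP; right; have := side_turn xt.
by rewrite [in turn (turn _)](far_crossed draw xd) (turn4 draw).
Qed.

Lemma side_nbr x y : side P x y -> exists2 d, org d = x & y \in nbr d.
Proof.
case/existsP=> d /andP[xd /orP[] /andP[/eqP Ex /eqP Ey]].
  by exists d => //; rewrite !inE -Ey xd eqxx orbT.
exists (turn d) => //; rewrite !inE (crossed_turn draw) xd /=.
have -> : turn (far (turn d)) = d.
  by rewrite (far_crossed draw) ?(crossed_turn draw) // (turn4 draw).
by rewrite Ex eqxx !orbT.
Qed.

(** The far end is not in an older component, where the crossing would be decided, nor in the
    current one, where it would be marked. So it is unlabelled and isolated in [F], and the only
    possible obstacle is a side from the current component, which would have marked it. *)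
Lemma decide_free st F d : growing st F -> choosing st F ->
    popped st = size (queue st) -> d \in queue st -> lab st d = stamp st ->
    crossed d -> dec st (org (twin d)) = 0 -> mark st (org (far d)) != stamp st ->
  lab st (far d) = 0 /\ ~~ joined P F (org d) (org (far d)).
Proof.
move=> gr ch Ep dq dcur xd dec0 mark_far.
have mk e : e \in queue st -> lab st e = stamp st -> {in nbr e, forall y, mark st y = stamp st}.
  by have := gr_mark gr; rewrite Ep take_size; apply.
have lab_far : lab st (far d) = 0.
  apply/eqP/contraT; rewrite (gr_lab gr) => fq.
  have [|old] := eqVneq (lab st (far d)) (stamp st).
    by move=> /(mk _ fq)/(_ (org (far d))) Em; rewrite Em ?eqxx // inE /= eqxx in mark_far.
  have : far d \in take (decided st) (queue st).
    move: fq; rewrite -{1}(cat_take_drop (decided st) (queue st)) mem_cat => /orP[//|].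
    by move/(gr_current gr)/eqP; rewrite (negPf old).
  move=> /(ch_decided ch); rewrite (crossed_far draw xd) => /(_ isT).
  by rewrite (far_crossed draw xd) !(org_twin_turn draw) dec0.
split=> //; apply/existsP=> -[s /existsP[t /and3P[conn_s conn_t st_side]]].
have t_far : t = org (far d).
  have : conn P F (org (far d)) t.
    by rewrite /conn (conn_sym draw (tree_diagonals (gr_tree gr))).
  case/connectP=> -[|x p] //= /andP[/exists_inP[f fF /andP[/eqP Ef _]] _] _.
  have [fq _] := gr_forest gr fF.
  have : lab st (far d) != 0 by rewrite (growing_vertex gr Ep fq Ef) (gr_lab gr).
  by rewrite lab_far.
have [e [eq ecur Es]] : exists e, [/\ e \in queue st, lab st e = stamp st & org e = s].
  case/connectP: conn_s => p.
  elim: p d dq dcur {xd dec0 mark_far lab_far t_far conn_t} => [|x p IHp] d dq dcur /=.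
    by move=> _ Es; exists d.
  case/andP=> /exists_inP[f fF /andP[/eqP Ef /eqP <-]] pth_p Es.
  have [fq fl] := gr_forest gr fF.
  have fcur : lab st f = stamp st by rewrite -dcur; apply: (growing_vertex gr Ep).
  apply: (IHp (far f)) => //; last by rewrite fl.
  by rewrite -(gr_lab gr) fl (gr_lab gr).
case/eqP: mark_far; case/orP: st_side => [/eqP Est|/side_nbr[f Ef ft]].
  by apply: (mk e) => //; rewrite inE /= -t_far -Est Es eqxx.
have fl : lab st f = stamp st by rewrite -ecur; apply: (growing_vertex gr Ep) => //; rewrite Es Ef.
have fq : f \in queue st by rewrite -(gr_lab gr) fl -ecur (gr_lab gr).
by apply: (mk f) => //; rewrite -t_far.
Qed.

Lemma same_crossing d e : crossed d -> org (twin e) = org (twin d) ->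
  [\/ e = d, e = turn d, e = far d | e = turn (far d)].
Proof.
move=> xd /esym/eqP; rewrite -(org_orbit draw) fconnect_orbit /orbit (order_crossing draw) //=.
rewrite -!(twin_turn draw) !inE !(inj_eq (inv_inj (twinK draw))) (far_crossed draw xd).
by case/or4P=> /eqP->; [constructor 1|constructor 2|constructor 3|constructor 4].
Qed.

(** Serves both outcomes: either the chosen edge enters [F1], or [F1 = F] and the obstacle to the
    crossing edge is supplied. *)
Lemma choosing_choose st F F1 d : choosing st F -> F \subset F1 -> diagonals P F1 ->
    crossed d -> dec st (org (twin d)) = 0 ->
    (forall e, e \in F1 -> e \notin F -> e = d \/ e = far d) ->
    (d \notin F1 -> joined P F1 (org (turn d)) (org (far (turn d)))) ->
  choosing (choose st d) F1.
Proof.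
move=> [dc o1 o2 o3 o4 o5] sF diagF1 xd dec0 F1F jnd.
have Eft := far_crossed draw xd; have rd := crossed_real draw xd.
have xt : crossed (turn d) by rewrite (crossed_turn draw).
have [out_d out_t] : out st d = 0 /\ out st (turn d) = 0.
  by have := o1 d xd; rewrite dec0; lia.
have out'E e : out (choose st d) e = if (e == d) || (e == far d) then 1 else out st e.
  by rewrite /= /upd; case: (e == d); case: (e == far d).
have [neq1 neq3 neq4 neq6] :
    [/\ turn d != d, turn (far d) != d, turn d != far d & turn (far d) != far d].
  have := turn_uniq draw xd; rewrite -Eft /= !inE !negb_or [d == turn d]eq_sym.
  rewrite [d == turn _]eq_sym [far d == _]eq_sym.
  by case/andP=> /and3P[-> _ ->] /andP[/andP[-> _] /andP[-> _]].
have tfd : turn (turn (far d)) = d by rewrite Eft (turn4 draw).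
split.
- by move=> e et xe; rewrite /= /upd; case: ifP => // _; apply: dc.
- move=> e xe; rewrite !out'E /= updE; case: (eqVneq (org (twin e)) (org (twin d))) => [Ex|neq_x].
    case: (same_crossing xd Ex) => ->; rewrite ?eqxx ?(negPf neq1) ?(negPf neq4) //= ?orbT.
    + by rewrite out_t.
    + by rewrite -Eft eqxx orbT out_t.
    + by rewrite (negPf neq3) (negPf neq6) -(far_turn draw xd) o2 // out_t.
    by rewrite tfd eqxx (negPf neq3) (negPf neq6) -(far_turn draw xd) o2 // out_t.
  have neq f : org (twin f) = org (twin d) -> (e == f) = false /\ (turn e == f) = false.
    move=> Ef; split; apply: contraNF neq_x => /eqP E1; subst f; first by rewrite Ef.
    by rewrite -Ef (org_twin_turn draw).
  have [-> ->] := neq d erefl.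
  have [|-> ->] := neq (far d); first by rewrite Eft !(org_twin_turn draw).
  exact: o1.
- move=> e xe; rewrite !out'E o2 // -{1}(farK draw rd) orbC.
  have far_inj a b : real P a -> real P b -> (far a == far b) = (a == b).
    by move=> ra rb; rewrite -(inj_in_eq (can_in_inj (fun x (rx : x \in real P) => farK draw rx))).
  have re := crossed_real draw xe.
  by rewrite !far_inj ?(real_far draw).
- move=> e xe; rewrite out'E o3 // ifN //; apply: contra xe => /orP[/eqP->|/eqP->] //.
  exact: (crossed_far draw xd).
- move=> e eF1; rewrite out'E; case: ifP => // /negbT/norP[ed ef].
  apply: o4; apply: contraT => eF; have [Ee|Ee] := F1F e eF1 eF.
    by rewrite Ee eqxx in ed.
  by rewrite Ee eqxx in ef.
move=> e; rewrite out'E => oe eF1; have eF : e \notin F.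
  by apply: contra eF1; apply: (subsetP sF).
move: oe; case: ifP => [/orP[] /eqP Ee _|_ oe].
- by subst e; apply: jnd.
- subst e; have dF1 : d \notin F1 by rewrite -(diagonals_farE draw diagF1).
  have := jnd dF1; rewrite (far_turn draw xd) (far_turn draw (crossed_far draw xd)) (farK draw rd).
  by move=> j; apply: (joinedC draw diagF1 j).
exact: sub_joined sF (o5 e oe eF).
Qed.

Definition invariant st F := growing st F /\ choosing st F.

Lemma invariant_decide st F d s : invariant st F -> popped st = size (queue st) ->
  drop (decided st) (queue st) = d :: s -> exists F1, invariant (decide_step st d) F1.
Proof.
move=> [gr ch] Ep Ed; rewrite /decide_step.
have dd : d \in drop (decided st) (queue st) by rewrite Ed mem_head.
have dq : d \in queue st := mem_drop dd.
have dcur : lab st d = stamp st by apply: (gr_current gr).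
have st0 : 0 < stamp st by rewrite -dcur lt0n (gr_lab gr).
have lt_d : decided st < size (queue st) by rewrite -subn_gt0 -size_drop Ed.
have nthd : nth d (queue st) (decided st) = d.
  by rewrite -[decided st in LHS]addn0 -nth_drop Ed.
set st1 := if _ then _ else _.
suff [F1 [gr1 ch1 [Eq Ede Epo]] dec1] : exists2 F1, [/\ growing st1 F1, choosing st1 F1
    & [/\ exists q, queue st1 = queue st ++ q, decided st1 = decided st & popped st1 = popped st]]
    & crossed d -> dec st1 (org (twin d)) != 0.
  exists F1; split; first by apply: growing_incr_decided; rewrite // Ede Epo Ep.
  case: ch1 => c1 c2 c3 c4 c5 c6; split=> //= e.
  have [q Eq1] := Eq; rewrite Ede Eq1 takel_cat // (take_nth d) // nthd mem_rcons in_cons.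
  case/predU1P=> [->//|et]; apply: c1.
  by rewrite Ede Eq1 takel_cat // ltnW.
rewrite /st1; case: ifP => [/andP[xd /eqP dec0]|dec_ok]; last first.
  exists F; first by split=> //; split=> //; exists [::]; rewrite cats0.
  by move=> xd; rewrite xd /= in dec_ok; rewrite dec_ok.
have treeF := gr_tree gr; have diagF := tree_diagonals treeF.
have xf : crossed (far d) by rewrite (crossed_far draw).
have rd := crossed_real draw xd.
have xt : crossed (turn d) by rewrite (crossed_turn draw).
have [out_d out_t] : out st d = 0 /\ out st (turn d) = 0.
  by have := ch_out ch xd; rewrite dec0; lia.
have out_F e : out st e = 0 -> e \notin F.
  by move=> oe; apply/negP=> /(ch_forest ch); rewrite oe.
case: ifP => [/eqP marked|/negbT not_marked].
  (* The edge of [d] is obstructed: the crossing edge is chosen without being followed, and the dart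
     which set the mark provides the obstacle for [ch_blocked]. *)
  exists F; last by move=> _; rewrite /= /upd (org_twin_turn draw) eqxx.
  split; last by split=> //; exists [::]; rewrite cats0.
    exact: growing_choose.
  apply: (choosing_choose ch) => //; first by rewrite (org_twin_turn draw).
    by move=> e eF; rewrite eF.
  move=> _; rewrite -(far_crossed draw xd) (farK draw rd).
  apply: (joinedC draw diagF).
  have [e [eq le ye]] : exists e, [/\ e \in queue st, lab st e = stamp st
      & org (far d) \in nbr e].
    by rewrite -marked; apply: (gr_marked gr); rewrite marked -lt0n.
  apply/existsP; exists (org e); apply/existsP; exists (org (far d)).
  rewrite nbr_side // andbT /conn connect0 andbT; apply: (gr_conn gr) => //.
  by rewrite le.
have [lab_far not_joined] := decide_free gr ch Ep dq dcur xd dec0 not_marked.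
pose F1 := add_diagonal P F d.
have tree1 : tree_like P rv F1 by apply: (tree_like_add draw) => //; apply: out_F.
have sF : F \subset F1 by apply: sub_add_diagonal.
have F1F e : e \in F1 -> e \notin F -> e = d \/ e = far d.
  by rewrite !in_setU1 => /or3P[/eqP|/eqP|->]; [left|right|].
have dF1 : d \in F1 by apply: setU11.
exists F1; last by move=> _; rewrite /= /upd eqxx.
split; last by split=> //; exists [:: far d]; rewrite cats1.
  apply: (@growing_push (choose st d) F F1 (far d)) => //.
  - exact: growing_choose.
  - exact: (real_far draw rd).
  - move=> e eq le; have cd : conn P F1 (org d) (org (far d)) by apply: conn_dart.
    apply: conn_trans cd.
    by apply: (sub_conn sF); apply: (gr_conn gr) => //; rewrite le.
  move=> e eF1 eF; rewrite /=.
  have lab_d : upd (lab st) (far d) (stamp st) d = stamp st by rewrite /upd; case: ifP.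
  have lab_f : upd (lab st) (far d) (stamp st) (far d) = stamp st by rewrite /upd eqxx.
  by case: (F1F e eF1 eF) => ->; rewrite ?(farK draw).
have ch1 : choosing (choose st d) F1.
  apply: (choosing_choose ch) => //; first exact: tree_diagonals tree1.
  by rewrite dF1.
case: ch1 => c1 c2 c3 c4 c5 c6; split=> //= e; rewrite -cats1 takel_cat ?(ltnW lt_d) //.
exact: c1.
Qed.

(** The increased stamp exceeds all labels, so the conditions on the current component hold
    vacuously before the first dart is pushed. *)
Lemma invariant_scan st F d : invariant st F -> decided st = size (queue st) ->
  val d = scanned st -> invariant (scan_step st d) F.
Proof.
move=> [gr ch] Ede Ed; rewrite /scan_step; set st1 := if _ then _ else _.
have Ep : popped st = size (queue st).
  by apply/eqP; rewrite eqn_leq (gr_popped gr) -Ede (gr_decided gr).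
suff [gr1 dq Es] : [/\ growing st1 F, real P d -> d \in queue st1 & scanned st1 = scanned st].
  split.
    case: gr1 => tree uq rl labE le_st le_dp le_p le_s nx fo cn mk mkd cur sc.
    split=> //=; first by rewrite Es -Ed ltn_ord.
    move=> e re; rewrite ltnS leq_eqVlt => /predU1P[Ee|]; last exact: sc.
    have Eed : e = d by apply: val_inj; rewrite Ed -Es.
    by rewrite Eed; apply: dq; rewrite -Eed.
  case: ch => c1 c2 c3 c4 c5 c6; rewrite /st1.
  case: ifP => _; split=> //= e; rewrite -cats1 takel_cat ?Ede //.
  by rewrite -Ede; apply: c1.
rewrite /st1; case: ifP => [/andP[rd /eqP lab0]|/negbT]; last first.
  by rewrite negb_and => dl; split=> // rd; move: dl; rewrite rd /= (gr_lab gr).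
split=> //; last by rewrite mem_rcons mem_head.
apply: (@growing_push (incr_stamp st) F F d) => //=; last by move=> e ->.
- case: gr => tree uq rl labE le_st le_dp le_p le_s nx fo cn mk mkd cur sc.
  split=> //=.
  + by move=> e; apply: leqW.
  + by move=> e _ le; have := le_st e; rewrite le ltnn.
  by rewrite Ede drop_size => e.
- exact: gr_tree gr.
by move=> e _ le; have := gr_stamp gr e; rewrite le ltnn.
Qed.

(** Every step increments exactly one of the three counters, none of which exceeds [nd]. *)
Definition progress st := popped st + decided st + scanned st.

Lemma invariant_step st F : invariant st F -> running st ->
  (exists F1, invariant (step st) F1) /\ progress (step st) = (progress st).+1.
Proof.
move=> inv; have [gr ch] := inv; rewrite /running /step.
case Edp: (drop (popped st) (queue st)) => [|d s] /=; last first.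
  split; last by rewrite /progress /pop_step /=; case: ifP => _ /=; lia.
  exists F; split; first exact: growing_pop gr Edp.
  apply: choosing_pop => //; first exact: gr_decided gr.
  by rewrite -subn_gt0 -size_drop Edp.
have Ep : popped st = size (queue st).
  apply/eqP; rewrite eqn_leq (gr_popped gr) -subn_eq0 -size_drop Edp //.
rewrite {1}Ep ltnn /=.
case Edd: (drop (decided st) (queue st)) => [|d s] /=; last first.
  split; first exact: invariant_decide inv Ep Edd.
  by rewrite /progress /decide_step /=; case: ifP => _ /=; [case: ifP => _ /=|]; lia.
have Ede : decided st = size (queue st).
  apply/eqP; rewrite eqn_leq -{1}Ep (gr_decided gr) -subn_eq0 -size_drop Edd //.
rewrite Ede ltnn /= => lt_s; rewrite insubT /=.
split; first by exists F; apply: invariant_scan.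
by rewrite /progress /scan_step /=; case: ifP => _ /=; lia.
Qed.

Lemma invariant_init : invariant init_state set0.
Proof.
split.
  split=> //=; first exact: (tree_like0 draw).
  by move=> d; rewrite inE.
split=> //= d; by rewrite inE.
Qed.

Lemma progress_bound st F : invariant st F -> progress st <= 3 * nd.
Proof.
case=> gr _; have le_q : size (queue st) <= nd.
  by rewrite -(card_uniqP (gr_uniq gr)) -[leqRHS]card_ord max_card.
have := gr_decided gr; have := gr_popped gr; have := gr_scanned gr.
rewrite /progress; lia.
Qed.

(** At the end every dart at a real vertex has been scanned, queued and decided; hence every
    crossing has exactly one chosen edge. *)
Lemma final_out st F : invariant st F -> ~~ running st ->
  let T := [set d | out st d != 0] in
  [/\ tree_like P rv T, forall d, crossed d -> (turn d \in T) = (d \notin T)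
    & forall d, out st d = (d \in T)].
Proof.
move=> [gr ch]; rewrite /running !negb_or -!leqNgt => /and3P[le_p le_d le_s]; set T := [set d | out st d != 0].
have dec_all d : crossed d -> dec st (org (twin d)) != 0.
  move=> xd; apply: (ch_decided ch) => //; rewrite take_oversize //.
  by apply: (gr_scan gr); [exact: (crossed_real draw xd) | exact: leq_trans le_s].
have out_sum d : crossed d -> out st d + out st (turn d) = 1.
  by move=> xd; rewrite (ch_out ch) // dec_all.
have T_crossed d : d \in T -> crossed d.
  by rewrite inE; apply: contraR => /(ch_uncrossed ch) ->.
have T_turn d : crossed d -> (turn d \in T) = (d \notin T).
  by move=> /out_sum; rewrite !inE; lia.
have diagT : diagonals P T.
  split=> [//|d|d] dT; first by rewrite inE (ch_far ch) ?T_crossed //; rewrite inE in dT.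
  by rewrite T_turn ?T_crossed // dT.
split=> // [|d].
  apply: (tree_like_complete draw (gr_tree gr)) => //.
    by apply/subsetP=> d dF; rewrite inE (ch_forest ch).
  by move=> d; rewrite inE; apply: (ch_blocked ch).
rewrite inE; case xd: (crossed d); first by have := out_sum d xd; lia.
by rewrite (ch_uncrossed ch) ?xd.
Qed.

End Invariant.
End Algorithm.

(** * Implementation *)

Section LoopFree.
Implicit Types (m : memory) (e : expr) (c : com).

Fixpoint run c m : memory :=
  match c with
  | Skip | While _ _ => m
  | Store a i e => update m a (eval m i) (eval m e)
  | Seq c1 c2 => run c2 (run c1 m)
  | If e c1 c2 => if eval m e != 0 then run c1 m else run c2 m
  end.

(** Both branches of a conditional are added: a crude bound, but independent of the memory. *)
Fixpoint time c : nat :=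
  match c with
  | Skip => 1
  | While _ _ => 0
  | Store a i e => (cost i + cost e).+1
  | Seq c1 c2 => (time c1 + time c2).+1
  | If e c1 c2 => (cost e + (time c1 + time c2)).+1
  end.

(** A factor by which evaluation can exceed the largest value in memory; a constant counts with its
    value. *)
Fixpoint expr_size e : nat :=
  match e with
  | Const k => k
  | Read _ i => (expr_size i).+1
  | Add e1 e2 | Sub e1 e2 => expr_size e1 + expr_size e2
  end.

Fixpoint com_size c : nat :=
  match c with
  | Skip | While _ _ => 0
  | Store a i e => expr_size i + expr_size e
  | Seq c1 c2 => com_size c1 + com_size c2
  | If e c1 c2 => expr_size e + (com_size c1 + com_size c2)
  end.

Fixpoint stores c : nat :=
  match c with
  | Skip | While _ _ => 0
  | Store a i e => 1
  | Seq c1 c2 => stores c1 + stores c2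
  | If e c1 c2 => stores c1 + stores c2
  end.

(* Loop-free programs which store no value larger than one plus the largest
   value in memory. *)
Fixpoint tame c : bool :=
  match c with
  | Skip => true
  | Store a i e => if e is (Read _ _ | Const 1 | Add (Read _ _) (Const 1)) then true else false
  | Seq c1 c2 => tame c1 && tame c2
  | If e c1 c2 => tame c1 && tame c2
  | While _ _ => false
  end.

Definition bounded m M := forall a i, m a i <= M.

Lemma eval_bound m M e : 0 < M -> bounded m M -> eval m e <= expr_size e * M.
Proof.
move=> M0 bm; elim: e => [k|a e _|e1 IH1 e2 IH2|e1 IH1 e2 IH2] /=.
- by rewrite leq_pmulr.
- by rewrite mulSn (leq_trans (bm _ _)) ?leq_addr.
- by rewrite mulnDl leq_add.
by rewrite mulnDl (leq_trans (leq_subr _ _)) // (leq_trans IH1) ?leq_addr.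
Qed.

Lemma fits_bound W m M e : 0 < M -> bounded m M -> expr_size e * M < W -> fits W m e.
Proof.
move=> M0 bm; elim: e => [k|a e IH|e1 IH1 e2 IH2|e1 IH1 e2 IH2] ltW;
  apply/andP; split=> //; try exact: leq_ltn_trans (eval_bound _ M0 bm) ltW.
- by apply: IH; apply: leq_ltn_trans ltW; rewrite leq_mul2r leqnSn orbT.
- by apply/andP; split; [apply: IH1 | apply: IH2]; apply: leq_ltn_trans ltW;
    rewrite leq_mul2r ?leq_addl ?leq_addr orbT.
by apply/andP; split; [apply: IH1 | apply: IH2]; apply: leq_ltn_trans ltW;
  rewrite leq_mul2r ?leq_addl ?leq_addr orbT.
Qed.

Lemma bounded_leq m M M' : M <= M' -> bounded m M -> bounded m M'.
Proof. by move=> le_M bm a i; apply: leq_trans le_M. Qed.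

(** Each store of a tame program raises the bound on the memory by at most one, so [stores c]
    measures the growth during one run. *)
Lemma run_exec W c m M : tame c -> 0 < M -> bounded m M ->
    com_size c * (M + stores c) < W ->
  bounded (run c m) (M + stores c) /\ exists2 t, t <= time c & exec W c m t (run c m).
Proof.
elim: c m M => [|a i e|c1 IH1 c2 IH2|e c1 IH1 c2 IH2|//] m M /=.
- move=> _ _ bm _; rewrite addn0; split=> //; exists 1 => //; exact: ExecSkip.
- move=> tm M0 bm ltW; have M1 : 0 < M + 1 by rewrite addn1.
  have bm1 := bounded_leq (leq_addr 1 M) bm.
  split; last first.
    exists (cost i + cost e).+1 => //; apply: ExecStore;
      apply: fits_bound M1 bm1 _; apply: leq_ltn_trans ltW;
      by rewrite leq_mul2r ?leq_addl ?leq_addr orbT.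
  move=> a' i'; rewrite /update; case: ifP => _; last exact: bm1.
  case: e tm {ltW} => [[|[|k]]|a1 e1|[|a1 e1||] // [[|[|k]]|||]|] //= _.
  by rewrite leq_add2r.
- case/andP=> tm1 tm2 M0 bm ltW; set s1 := stores c1; set s2 := stores c2.
  have [|b1 [t1 le1 x1]] := IH1 m M tm1 M0 bm.
    by apply: leq_ltn_trans ltW; apply: leq_mul; rewrite ?leq_addr // addnA leq_addr.
  have [||b2 [t2 le2 x2]] := IH2 (run c1 m) (M + s1) tm2 _ b1.
  + by rewrite addn_gt0 M0.
  + by apply: leq_ltn_trans ltW; apply: leq_mul; rewrite ?leq_addl // addnA.
  rewrite addnA; split=> //; exists (t1 + t2).+1; first by rewrite ltnS leq_add.
  exact: ExecSeq x1 x2.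
case/andP=> tm1 tm2 M0 bm ltW.
have fe : fits W m e.
  apply: (fits_bound M0 bm); apply: leq_ltn_trans ltW.
  by apply: leq_mul; rewrite ?leq_addr.
case: ifP => e0.
  have [|b1 [t1 le1 x1]] := IH1 m M tm1 M0 bm.
    apply: leq_ltn_trans ltW; apply: leq_mul; last by rewrite addnA leq_addr.
    by rewrite addnCA leq_addr.
  split; first by apply: bounded_leq b1; rewrite addnA leq_addr.
  exists (cost e + t1).+1; first by lia.
  by apply: ExecIfTrue.
have [|b1 [t1 le1 x1]] := IH2 m M tm2 M0 bm.
  apply: leq_ltn_trans ltW; apply: leq_mul; last by lia.
  by rewrite addnA leq_addl.
split; first by apply: bounded_leq b1; lia.
exists (cost e + t1).+1; first by lia.
by apply: ExecIfFalse => //; rewrite -[_ == _]negbK e0.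
Qed.

(** The index of [Inv] bounds the remaining iterations. It limits the time and also the growth of
    the stored values, so that one word size fits the whole loop. *)
Lemma while_exec W e c (Inv : nat -> memory -> Prop) : tame c ->
    (forall n m, Inv n m -> eval m e != 0 -> 0 < n /\ Inv n.-1 (run c m)) ->
  forall n m M, Inv n m -> 0 < M -> bounded m M ->
    (expr_size e + com_size c) * (M + stores c * n) < W ->
  exists t m', [/\ exec W (While e c) m t m', exists n', Inv n' m', eval m' e = 0
    & t <= n.+1 * (cost e + time c).+1].
Proof.
move=> tm step; elim=> [|n IHn] m M inv M0 bm ltW.
  exists (cost e).+1, m; have e0 : eval m e = 0.
    by apply/eqP; apply: contraT => /(step _ _ inv)[].
  split=> //; [|by exists 0|by rewrite mul1n ltnS leq_addr].
  apply: ExecWhileFalse; last by rewrite e0.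
  apply: (fits_bound M0 bm); apply: leq_ltn_trans ltW.
  by rewrite muln0 addn0 leq_mul2r leq_addr orbT.
have fe : fits W m e.
  apply: (fits_bound M0 bm); apply: leq_ltn_trans ltW.
  by apply: leq_mul; rewrite leq_addr.
have [e0|e0] := eqVneq (eval m e) 0.
  exists (cost e).+1, m; split=> //; [|by exists n.+1|].
    by apply: ExecWhileFalse; rewrite ?e0.
  by rewrite mulSn -addSn (leq_trans _ (leq_addr _ _)) // ltnS leq_addr.
have [_ inv1] := step _ _ inv e0.
have [|b1 [t1 le1 x1]] := @run_exec W c m M tm M0 bm.
  apply: leq_ltn_trans ltW; apply: leq_mul; first exact: leq_addl.
  by rewrite leq_add2l leq_pmulr.
have [|||t2 [m' [x2 inv2 e2 le2]]] := IHn (run c m) (M + stores c) inv1.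
- by rewrite addn_gt0 M0.
- exact: b1.
- by rewrite -addnA -mulnS.
exists (cost e + t1 + t2).+1, m'; split=> //.
  exact: ExecWhileTrue x1 x2.
by rewrite mulSn; lia.
Qed.

End LoopFree.

(* Array 6 holds the sizes and counters of the state, in the order of
   [simulates] below, and the three registers 5, 6 and 7; arrays 7 to 10 hold [queue], [lab],
   [mark] and [dec], and array 5 holds [out]. *)
Definition cell k := Read 6 (Const k).
Definition set_cell k e := Store 6 (Const k) e.
Definition incr_cell k := set_cell k (Add (cell k) (Const 1)).
Definition org_e := Read 1.
Definition twin_e := Read 2.
Definition next_e := Read 3.
Definition turn_e e := twin_e (next_e (twin_e e)).
Definition crossing_e := Read 4.

(** Register 6 holds the dart to be pushed. Of the others, 5 holds the dart being processed and 7
    the dart to be chosen. *)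
Definition push_c :=
  Seq (Store 7 (cell 0) (cell 6)) (Seq (Store 8 (cell 6) (cell 4)) (incr_cell 0)).

Definition mark_c e := Store 9 (org_e e) (cell 4).

Definition choose_c :=
  Seq (Store 10 (org_e (twin_e (cell 7))) (Const 1))
 (Seq (Store 5 (cell 7) (Const 1)) (Store 5 (turn_e (turn_e (cell 7))) (Const 1))).

(** Three turns reach [turn (far d)], since [far d] is two turns away at a crossing. *)
Definition pop_c :=
  Seq (set_cell 5 (Read 7 (cell 1)))
 (Seq (set_cell 6 (next_e (cell 5)))
 (Seq (If (Read 8 (cell 6)) Skip push_c)
 (Seq (mark_c (cell 5))
 (Seq (If (crossing_e (org_e (twin_e (cell 5))))
        (Seq (mark_c (turn_e (cell 5)))
             (mark_c (turn_e (turn_e (turn_e (cell 5)))))) Skip)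
      (incr_cell 1))))).

(** The sum of the two truncated differences vanishes iff mark and stamp are equal, so its first
    branch is the unmarked case. *)
Definition decide_c :=
  Seq (set_cell 5 (Read 7 (cell 2)))
 (Seq (If (crossing_e (org_e (twin_e (cell 5))))
        (If (Read 10 (org_e (twin_e (cell 5)))) Skip
         (Seq (set_cell 6 (turn_e (turn_e (cell 5))))
           (If (Add (Sub (Read 9 (org_e (cell 6))) (cell 4))
                    (Sub (cell 4) (Read 9 (org_e (cell 6)))))
             (Seq (set_cell 7 (cell 5)) (Seq choose_c push_c))
             (Seq (set_cell 7 (turn_e (cell 5))) choose_c))))
        Skip)
      (incr_cell 2)).

Definition scan_c :=
  Seq (set_cell 6 (cell 3))
 (Seq (If (crossing_e (org_e (cell 6))) Skip
        (If (Read 8 (cell 6)) Skip (Seq (incr_cell 4) push_c)))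
      (incr_cell 3)).

Definition step_c :=
  If (Sub (cell 0) (cell 1)) pop_c (If (Sub (cell 0) (cell 2)) decide_c scan_c).

Definition running_e :=
  Add (Sub (cell 0) (cell 1)) (Add (Sub (cell 0) (cell 2)) (Sub (Read 0 (Const 1)) (cell 3))).

(** * Simulation of the abstract states in memory *)

Section Simulation.
Variables (nv nd : nat) (P : planarization 'I_nv 'I_nd).
Implicit Types (m : memory) (st : state 'I_nv 'I_nd) (d e : 'I_nd).

Local Notation org := (org P).
Local Notation twin := (twin P).
Local Notation next := (next P).
Local Notation turn := (turn P).
Local Notation far := (far P).
Local Notation crossed := (crossed P).

Record stored m : Prop := {
  in_nd : m 0 1 = nd;
  in_org : forall d, m 1 d = org d;
  in_twin : forall d, m 2 d = twin d;
  in_next : forall d, m 3 d = next d;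
  in_crossing : forall x : 'I_nv, m 4 x = crossing P x
}.

Record simulates m st : Prop := {
  sim_stored : stored m;
  sim_size : m 6 0 = size (queue st);
  sim_popped : m 6 1 = popped st;
  sim_decided : m 6 2 = decided st;
  sim_scanned : m 6 3 = scanned st;
  sim_stamp : m 6 4 = stamp st;
  sim_queue : forall i, i < size (queue st) -> m 7 i = nth 0 (map val (queue st)) i;
  sim_lab : forall d, m 8 d = lab st d;
  sim_mark : forall x : 'I_nv, m 9 x = mark st x;
  sim_dec : forall x : 'I_nv, m 10 x = dec st x;
  sim_out : forall d, m 5 d = out st d
}.

Lemma sim_init : simulates (input P) (init_state _ _).
Proof.
have tabE (n : nat) (f : 'I_n -> nat) (i : 'I_n) : tabulate f i = f i.
  by rewrite /tabulate valK.
by split=> //; split=> //= i; rewrite tabE.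
Qed.

Lemma run_seq c1 c2 m : run (Seq c1 c2) m = run c2 (run c1 m).
Proof. by []. Qed.

Lemma run_if (e : expr) c1 c2 m :
  run (If e c1 c2) m = if eval m e != 0 then run c1 m else run c2 m.
Proof. by []. Qed.

Lemma stored_incr m k : stored m -> stored (run (incr_cell k) m).
Proof. by case. Qed.

Lemma sim_register m st k (e : expr) : simulates m st -> 4 < k ->
  [/\ simulates (run (set_cell k e) m) st, run (set_cell k e) m 6 k = eval m e
    & forall j, j != k -> run (set_cell k e) m 6 j = m 6 j].
Proof.
case=> [[i0 i1 i2 i3 i4] s0 s1 s2 s3 s4 s5 s6 s7 s8 s9] k4.
split; [|by rewrite /= /update !eqxx|]; last first.
  by move=> j jk; rewrite /= /update (negPf jk) andbF.
by case: k k4 => [|[|[|[|[|k]]]]].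
Qed.

Lemma eval_turn m st (e : expr) (d : 'I_nd) : simulates m st -> eval m e = d ->
  eval m (turn_e e) = turn d.
Proof.
by case=> [[i0 i1 i2 i3 i4] _ _ _ _ _ _ _ _ _ _] Ee; rewrite /= Ee i2 i3 i2.
Qed.

Lemma eval_crossed m st (e : expr) (d : 'I_nd) : simulates m st -> eval m e = d ->
  eval m (crossing_e (org_e (twin_e e))) = crossed d.
Proof.
by case=> [[i0 i1 i2 i3 i4] _ _ _ _ _ _ _ _ _ _] Ee; rewrite /= Ee i2 i1 i4.
Qed.

Lemma sim_push m st e : simulates m st -> m 6 6 = e -> simulates (run push_c m) (push st e)
  /\ forall k, 0 < k -> run push_c m 6 k = m 6 k.
Proof.
case=> [[i0 i1 i2 i3 i4] s0 s1 s2 s3 s4 s5 s6 s7 s8 s9] Ee.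
split; last by case.
split=> //; rewrite /= /update ?eqxx /=.
- by rewrite s0 size_rcons addn1.
- move=> i; rewrite size_rcons ltnS leq_eqVlt s0 map_rcons nth_rcons size_map.
  by case: ltngtP => //= lt_i _; apply: s5.
by move=> d; rewrite Ee s4 /upd -val_eqE; case: ifP.
Qed.

Lemma sim_mark_c m st d (e : expr) : simulates m st -> eval m e = d ->
  let st1 := State (queue st) (popped st) (decided st) (scanned st) (stamp st) (lab st)
    (upd (mark st) (org d) (stamp st)) (dec st) (out st) in
  simulates (run (mark_c e) m) st1 /\ forall k, run (mark_c e) m 6 k = m 6 k.
Proof.
case=> [[i0 i1 i2 i3 i4] s0 s1 s2 s3 s4 s5 s6 s7 s8 s9] Ee /=.
split; last by [].
split=> //; rewrite /= /update ?eqxx /=.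
by move=> x; rewrite Ee i1 s4 /upd -val_eqE; case: ifP.
Qed.

Variables (V : finType) (E : {set {set V}}) (rv : V -> 'I_nv).
Hypothesis draw : one_planar_drawing E P rv.

Lemma sim_choose m st d : simulates m st -> m 6 7 = d -> crossed d ->
  simulates (run choose_c m) (choose P st d) /\ forall k, run choose_c m 6 k = m 6 k.
Proof.
case=> [[i0 i1 i2 i3 i4] s0 s1 s2 s3 s4 s5 s6 s7 s8 s9] Ed xd /=.
split; last by [].
split=> //; rewrite /= /update ?eqxx /=.
  by move=> x; rewrite Ed i2 i1 /upd -val_eqE; case: ifP.
move=> e; rewrite Ed !(i2, i3) /upd -!val_eqE /=.
rewrite (far_crossed draw xd) -/(turn d) -/(turn (turn d)).
by case: ifP => // _; case: ifP.
Qed.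

Lemma sim_pop m st d s : simulates m st -> drop (popped st) (queue st) = d :: s ->
  simulates (run pop_c m) (pop_step P st d).
Proof.
move=> sim Ed; rewrite /pop_c.
have lt_p : popped st < size (queue st) by rewrite -subn_gt0 -size_drop Ed.
have nthd : nth d (queue st) (popped st) = d.
  by rewrite -[popped st in LHS]addn0 -nth_drop Ed.
have Eq : eval m (Read 7 (cell 1)) = d.
  by rewrite /= (sim_popped sim) (sim_queue sim) // (nth_map d) // nthd.
rewrite run_seq; have [sim1 r5 _] := sim_register (Read 7 (cell 1)) sim (isT : 4 < 5).
rewrite {}Eq in r5; move: (run _ m) sim1 r5 => m1 sim1 r5.
have En : eval m1 (next_e (cell 5)) = next d.
  by rewrite /= r5 (in_next (sim_stored sim1)).
rewrite run_seq; have [sim2 r6 rj] := sim_register (next_e (cell 5)) sim1 (isT : 4 < 6).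
rewrite {}En in r6; have := rj 5 isT; rewrite r5 => {rj r5 sim1}.
move: (run _ m1) sim2 r6 => m2 sim2 r6 r5.
rewrite run_seq run_if [eval _ _](_ : _ = lab st (next d)); last first.
  by rewrite /= r6 (sim_lab sim2).
rewrite /pop_step; set st1 := if lab st (next d) == 0 then _ else _.
have [m3 -> [sim3 {}r5]] : exists2 m3, (if lab st (next d) != 0 then run Skip m2
    else run push_c m2) = m3 & simulates m3 st1 /\ m3 6 5 = d.
  rewrite /st1; case: eqP => _ /=; last by exists m2.
  by have [sp rp] := sim_push sim2 r6; exists (run push_c m2); rewrite ?rp.
have [sim4 rk] := sim_mark_c (e := cell 5) sim3 r5.
rewrite run_seq; move: (rk 5) sim4; rewrite r5; move: (run (mark_c _) m3) => m4 {}r5 sim4.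
rewrite run_seq run_if (eval_crossed (e := cell 5) sim4 r5) /mark_step.
set st4 := State _ _ _ _ _ _ _ _ _ in sim4.
have [m5 -> sim5] : exists2 m5, (if nat_of_bool (crossed d) != 0
    then run (Seq (mark_c (turn_e (cell 5))) (mark_c (turn_e (turn_e (turn_e (cell 5)))))) m4
    else run Skip m4) = m5 & simulates m5 (State (queue st4) (popped st4) (decided st4)
      (scanned st4) (stamp st4) (lab st4) (if crossed d then
        upd (upd (mark st4) (org (turn d)) (stamp st4)) (org (turn (far d))) (stamp st4)
        else mark st4) (dec st4) (out st4)).
  case xd: (crossed d); last by exists m4.
  rewrite run_seq; have [sim5 r5'] := sim_mark_c sim4 (eval_turn (e := cell 5) sim4 r5).
  move: (r5' 5) sim5; rewrite r5; move: (run (mark_c _) m4) => m5 {}r5 sim5.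
  have [] := sim_mark_c sim5 (eval_turn sim5 (eval_turn sim5 (eval_turn (e := cell 5) sim5 r5))).
  by rewrite -(far_crossed draw xd) => sim6 _; eexists.
by case: sim5 => [sm ? sp *]; split=> //; [apply: stored_incr | rewrite /= /update /= sp addn1].
Qed.

Lemma sim_decide m st d s : simulates m st -> drop (decided st) (queue st) = d :: s ->
  simulates (run decide_c m) (decide_step P st d).
Proof.
move=> sim Ed; rewrite /decide_c.
have lt_p : decided st < size (queue st) by rewrite -subn_gt0 -size_drop Ed.
have nthd : nth d (queue st) (decided st) = d.
  by rewrite -[decided st in LHS]addn0 -nth_drop Ed.
have Eq : eval m (Read 7 (cell 2)) = d.
  by rewrite /= (sim_decided sim) (sim_queue sim) // (nth_map d) // nthd.
rewrite run_seq; have [sim1 r5 _] := sim_register (Read 7 (cell 2)) sim (isT : 4 < 5).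
rewrite {}Eq in r5; move: (run _ m) sim1 r5 => m1 sim1 r5.
rewrite run_seq /decide_step; set m2 := run (If _ _ _) m1.
suff sim2 : simulates m2 (if crossed d && (dec st (org (twin d)) == 0)
      then if mark st (org (far d)) == stamp st then choose P st (turn d)
      else push (choose P st d) (far d) else st).
  by case: sim2 => [? ? ? sd *]; split=> //; [apply: stored_incr | rewrite /= /update /= sd addn1].
rewrite /m2 run_if (eval_crossed (e := cell 5) sim1 r5) {m2}.
case xd: (crossed d); last exact: sim1.
have xt : crossed (turn d) by rewrite (crossed_turn draw).
rewrite [nat_of_bool true != 0]/= andTb run_if [eval _ _](_ : _ = dec st (org (twin d))); last first.
  by rewrite /= r5 (in_twin (sim_stored sim1)) (in_org (sim_stored sim1)) (sim_dec sim1).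
case: eqP => [dec0|_]; last exact: sim1.
rewrite [~~ true]/=.
have Ef := eval_turn sim1 (eval_turn (e := cell 5) sim1 r5).
rewrite run_seq; have [sim2 r6 rj] := sim_register (turn_e (turn_e (cell 5))) sim1 (isT : 4 < 6).
rewrite {}Ef -(far_crossed draw xd) in r6; have := rj 5 isT; rewrite r5 => {rj r5 sim1}.
move: (run _ m1) sim2 r6 => m2 sim2 r6 r5.
rewrite run_if [eval _ _](_ : _ = (mark st (org (far d)) - stamp st)
    + (stamp st - mark st (org (far d)))); last first.
  by rewrite /= r6 (in_org (sim_stored sim2)) (sim_mark sim2) (sim_stamp sim2).
rewrite addn_eq0 !subn_eq0 -eqn_leq; case: eqP => _; rewrite ?[~~ true]/= ?[~~ false]/=.
  have Et := eval_turn (e := cell 5) sim2 r5.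
  have [sim3 r7 _] := sim_register (turn_e (cell 5)) sim2 (isT : 4 < 7).
  rewrite {}Et in r7; rewrite run_seq; move: (run (set_cell 7 _) m2) sim3 r7 => m3 sim3 r7.
  by have [] := sim_choose sim3 r7 xt.
have [sim3 r7 rj] := sim_register (cell 5) sim2 (isT : 4 < 7).
rewrite [eval _ _]r5 in r7; have := rj 6 isT; rewrite r6 => {rj r6 sim2}.
rewrite 2!run_seq; move: (run (set_cell 7 _) m2) sim3 r7 => m3 sim3 r7 r6.
have [sim4 rk] := sim_choose sim3 r7 xd.
have r6' : run choose_c m3 6 6 = far d by rewrite rk.
by have [] := sim_push sim4 r6'.
Qed.

Lemma sim_scan m st d : simulates m st -> val d = scanned st ->
  simulates (run scan_c m) (scan_step P st d).
Proof.
move=> sim Ed; rewrite /scan_c.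
rewrite run_seq; have [sim1 r6 _] := sim_register (cell 3) sim (isT : 4 < 6).
rewrite [eval _ _](sim_scanned sim) -Ed in r6; move: (run _ m) sim1 r6 => m1 sim1 r6.
have [_ Eo _ _ Ex] := sim_stored sim1.
rewrite run_seq /scan_step /real; set m2 := run (If _ _ _) m1.
suff sim2 : simulates m2 (if ~~ crossing P (org d) && (lab st d == 0)
    then push (incr_stamp st) d else st).
  by case: sim2 => [? ? ? ? ss *]; split=> //; [apply: stored_incr | rewrite /= /update /= ss addn1].
rewrite /m2 run_if [eval _ _](_ : _ = crossing P (org d) :> nat) {m2}; last first.
  by rewrite /= r6 Eo Ex.
case: (crossing P (org d)); first exact: sim1.
rewrite [nat_of_bool false != 0]/= run_if [eval _ _](_ : _ = lab st d); last by rewrite /= r6 (sim_lab sim1).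
case: (lab st d == 0); last exact: sim1.
have sim2 : simulates (run (incr_cell 4) m1) (incr_stamp st).
  by case: sim1 => [? ? ? ? ? sg *]; split=> //; [apply: stored_incr | rewrite /= /update /= sg addn1].
have r6' : run (incr_cell 4) m1 6 6 = d by [].
by have [] := sim_push sim2 r6'.
Qed.

Lemma sim_running m st : simulates m st -> (eval m running_e != 0) = running st.
Proof.
case=> [[i0 _ _ _ _] s0 s1 s2 s3 _ _ _ _ _ _]; rewrite /= i0 s0 s1 s2 s3 /running.
by rewrite !addn_eq0 !negb_and -!lt0n !subn_gt0.
Qed.

Lemma sim_step m st : simulates m st -> running st -> simulates (run step_c m) (step P st).
Proof.
move=> sim; rewrite /step_c run_if.
have -> : eval m (Sub (cell 0) (cell 1)) = size (queue st) - popped st.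
  by rewrite -(sim_size sim) -(sim_popped sim).
rewrite -lt0n subn_gt0 /running /step.
case: ltnP => [lt_p _|le_p]; rewrite ?orTb ?orFb.
  case Ed: (drop _ _) => [|d s]; last exact: sim_pop Ed.
  by move: lt_p; rewrite -subn_gt0 -size_drop Ed.
rewrite run_if (drop_oversize le_p).
have -> : eval m (Sub (cell 0) (cell 2)) = size (queue st) - decided st.
  by rewrite -(sim_size sim) -(sim_decided sim).
rewrite -lt0n subn_gt0; case: ltnP => [lt_d _|le_d lt_s].
  case Ed: (drop _ _) => [|d s]; last exact: sim_decide Ed.
  by move: lt_d; rewrite -subn_gt0 -size_drop Ed.
by rewrite (drop_oversize le_d) insubT; apply: sim_scan.
Qed.

End Simulation.

(** * Partitions of the edges *)

Lemma set2_eq (T : finType) (a b u v : T) :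
  [set u; v] = [set a; b] -> u = a /\ v = b \/ u = b /\ v = a.
Proof.
move=> Euv.
have /set2P u_ab : u \in [set a; b] by rewrite -Euv set21.
have /set2P v_ab : v \in [set a; b] by rewrite -Euv set22.
have /set2P a_uv : a \in [set u; v] by rewrite Euv set21.
have /set2P b_uv : b \in [set u; v] by rewrite Euv set22.
by case: u_ab v_ab a_uv b_uv => -> [] -> [] ? [] ?; auto.
Qed.

Section EdgePartition.
Variables (V X D : finType) (E : {set {set V}}) (P : planarization X D).
Variable rv : V -> X.
Hypothesis simpleE : simple_graph E.
Hypothesis draw : one_planar_drawing E P rv.

Local Notation ends d u v := (org P d = rv u /\ org P (far P d) = rv v).

Lemma dart_edge d u v : ends d u v -> [set u; v] \in E.
Proof.
case=> Eu Ev; have := opd_edges draw u v; case: (_ \in E) => // /eqP.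
by rewrite cards_eq0 => /eqP/setP/(_ d); rewrite !inE Eu Ev !eqxx.
Qed.

Lemma edge_dart u v : [set u; v] \in E -> exists d, ends d u v.
Proof.
move=> uv; have := opd_edges draw u v; rewrite uv => /eqP/cards1P[d /setP/(_ d)].
by rewrite !inE eqxx => /andP[/eqP ? /eqP ?]; exists d.
Qed.

Lemma dart_unique d e u v : ends d u v -> ends e u v -> d = e.
Proof.
move=> end_d end_e; have uv := dart_edge end_d.
have := opd_edges draw u v; rewrite uv => /eqP/cards1P[f /setP Ef].
case: end_d end_e => [d1 d2] [e1 e2].
have := Ef d; have := Ef e; rewrite !inE d1 d2 e1 e2 !eqxx /=.
by move=> /esym/eqP -> /esym/eqP ->.
Qed.

Lemma dart_loopless d u v : ends d u v -> u != v.
Proof.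
move/dart_edge/simpleE => E2; apply/eqP => Euv; move: E2.
by rewrite Euv setUid cards1.
Qed.

Section Part.
Variable S : {set D}.
Hypothesis S_real : forall d, d \in S -> real P d.
Hypothesis S_far : forall d, d \in S -> far P d \in S.

Lemma drawn_dart d u v : ends d u v -> ([set u; v] \in drawn P rv S) = (d \in S).
Proof.
move=> end_d; have [Eu Ev] := end_d; rewrite inE; apply/existsP/idP.
  case=> a /existsP[b /andP[/eqP Eab /exists_inP[e eS /andP[/eqP Ea /eqP Eb]]]].
  case: (set2_eq Eab) => -[ua vb]; subst a b.
    by rewrite (dart_unique end_d (conj Ea Eb)).
  have -> : d = far P e; last exact: S_far.
  by apply: dart_unique end_d _; rewrite (farK draw) ?S_real.
move=> dS; exists u; apply/existsP; exists v; rewrite eqxx /=.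
by apply/exists_inP; exists d; rewrite // Eu Ev !eqxx.
Qed.

Lemma drawnP e : reflect (exists u v d, [/\ e = [set u; v], ends d u v & d \in S])
  (e \in drawn P rv S).
Proof.
rewrite inE; apply: (iffP existsP).
  case=> u /existsP[v /andP[/eqP Ee /exists_inP[d dS /andP[/eqP Eu /eqP Ev]]]].
  by exists u, v, d.
case=> u [v [d [-> [Eu Ev] dS]]]; exists u; apply/existsP; exists v.
by rewrite eqxx; apply/exists_inP; exists d; rewrite // Eu Ev !eqxx.
Qed.

Lemma drawn_card u v :
  #|[set d in S | (org P d == rv u) && (org P (far P d) == rv v)]|
    = ([set u; v] \in drawn P rv S).
Proof.
have [d|no_dart] := pickP (fun d => (org P d == rv u) && (org P (far P d) == rv v)).
  case/andP=> /eqP Eu /eqP Ev; have end_d : ends d u v by [].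
  rewrite (drawn_dart end_d).
  have -> : [set d in S | (org P d == rv u) && (org P (far P d) == rv v)]
      = if d \in S then [set d] else set0.
    apply/setP=> e; rewrite inE; case: (boolP ((org P e == rv u) && (org P (far P e) == rv v))) => [|].
      move=> /andP[/eqP Eeu /eqP Eev]; have -> : e = d by apply: dart_unique end_d.
      by case: (d \in S); rewrite inE ?eqxx ?andbT.
    rewrite andbF; case: (d \in S); rewrite inE // => not_e.
    by apply/esym; apply: contraNF not_e => /eqP->; rewrite Eu Ev !eqxx.
  by case: (d \in S); rewrite ?cards1 ?cards0.
have no_uv : [set u; v] \notin E.
  by apply/negP=> /edge_dart[d [Eu Ev]]; have := no_dart d; rewrite Eu Ev !eqxx.
rewrite (_ : [set d in S | _] = set0) ?cards0; last first.
  by apply/setP=> d; rewrite !inE no_dart andbF.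
case: drawnP => // -[a [b [d [Eab end_d _]]]].
by case/negP: no_uv; rewrite Eab; apply: dart_edge end_d.
Qed.

Lemma part_bound : (forall d, d \in S -> crossed P d -> turn P d \notin S) ->
  #|S| <= 8 * #|V|.
Proof.
move=> S_turn; have plane := part_plane draw S_real S_far S_turn.
have -> : #|S| = #|{: {d | d \in S}}| by rewrite card_sig; apply: eq_card.
have endsP u : ends (val u) (org (part_rotation draw S_real S_far) u)
    (org (part_rotation draw S_real S_far) (twin (part_rotation draw S_real S_far) u)).
  by rewrite !rv_org_part.
apply: (simple_plane_bound plane) => [u|u v Eo Et].
  by rewrite eq_sym; apply: dart_loopless (endsP u).
by apply/val_inj/(dart_unique (endsP u)); rewrite Eo Et.
Qed.

End Part.
End EdgePartition.

(** * Linear bounds and correctness of the output *)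

Section Correctness.
Variables (V : finType) (E : {set {set V}}) (nv nd : nat).
Variables (P : planarization 'I_nv 'I_nd) (rv : V -> 'I_nv).
Hypothesis simpleE : simple_graph E.
Hypothesis draw : one_planar_drawing E P rv.

Lemma final_state : exists st F, invariant P rv st F /\ ~~ running st.
Proof.
suff run_from n st F : invariant P rv st F -> 3 * nd <= progress st + n ->
    exists st F, invariant P rv st F /\ ~~ running st.
  by apply: (run_from (3 * nd) _ _ (invariant_init draw)); apply: leq_addl.
elim: n st F => [|n IHn] st F inv le_n; case: (boolP (running st)) => [r|]; try by exists st, F.
  have [[F1 inv1] Ep] := invariant_step draw inv r.
  by have := progress_bound inv1; rewrite Ep; move: le_n; lia.
have [[F1 inv1] Ep] := invariant_step draw inv r.
by apply: (IHn _ _ inv1); rewrite Ep; move: le_n; lia.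
Qed.

(** The outcome of the algorithm splits the real darts into two plane parts of at most [8 * #|V|]
    darts each. Every dart at a crossing is the twin of a real one, which doubles the total of 16.
    There is no circularity: termination was counted in terms of [nd]. *)
Lemma dart_bound : nd <= 32 * #|V|.
Proof.
have [st [F [inv not_r]]] := final_state.
have [treeT T_turn _] := final_out draw inv not_r.
move: [set d | _] treeT T_turn => T treeT T_turn; have diagT := tree_diagonals treeT.
have T_real d : d \in T -> real P d.
  by move/(diagonals_crossed diagT)/(crossed_real draw).
pose S := [set d | real P d && (d \notin T)].
have S_real d : d \in S -> real P d by rewrite inE => /andP[].
have S_far d : d \in S -> far P d \in S.
  rewrite !inE => /andP[rd dT]; rewrite (real_far draw rd) /=.
  by apply: contra dT => /(diagonals_far diagT); rewrite (farK draw).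
have S_turn d : d \in S -> crossed P d -> turn P d \notin S.
  by rewrite !inE => /andP[_ dT] xd; rewrite T_turn // dT andbF.
have bS := part_bound simpleE draw S_real S_far S_turn.
have T_turn' d : d \in T -> crossed P d -> turn P d \notin T.
  by move=> dT _; apply: (diagonals_turn diagT).
have bT := part_bound simpleE draw T_real (diagonals_far diagT) T_turn'.
pose real_darts := [set d : 'I_nd | real P d].
have le_real : #|real_darts| <= 16 * #|V|.
  have sub : real_darts \subset S :|: T.
    by apply/subsetP=> d; rewrite !inE => ->; case: (d \in T) => //; rewrite orbT.
  have := subset_leq_card sub; have := cardsU S T; lia.
have all_darts : [set: 'I_nd] \subset real_darts :|: (twin P @: real_darts).
  apply/subsetP=> d _; rewrite inE; case: (boolP (d \in real_darts)) => //.
  rewrite inE negbK => /(opd_crossed_once draw) rd; apply/imsetP.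
  by exists (twin P d); rewrite ?inE // (twinK draw).
have le_im := leq_imset_card (twin P) real_darts.
have := subset_leq_card all_darts; rewrite cardsT card_ord => /leq_trans -> //.
rewrite cardsU (leq_trans (leq_subr _ _)) // (leq_trans (leq_add le_real (leq_trans le_im le_real))) //.
by rewrite -mulnDl.
Qed.

Lemma vertex_bound : nv <= #|V| + nd.
Proof.
have all_vertices : [set: 'I_nv] \subset (rv @: V) :|: (org P @: 'I_nd).
  apply/subsetP=> x _; rewrite inE; case: (boolP (crossing P x)) => [xx|].
    have : 0 < #|[set d | org P d == x]| by rewrite (opd_degree draw xx).
    case/card_gt0P=> d; rewrite inE => /eqP <-.
    by rewrite [X in _ || X](imset_f (org P)) ?orbT.
  by rewrite -(opd_rv_codom draw) => /codomP[v ->]; rewrite imset_f.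
have := subset_leq_card all_vertices; rewrite cardsT card_ord => /leq_trans -> //.
rewrite cardsU (leq_trans (leq_subr _ _)) // leq_add // ?(leq_trans (leq_imset_card _ _)) //.
by rewrite card_ord.
Qed.

Lemma input_bound : bounded (input P) (nv + nd + 1).
Proof.
have tabE n (f : 'I_n -> nat) M : (forall i, f i <= M) -> forall i, tabulate f i <= M.
  by move=> fM i; rewrite /tabulate; case: insubP.
move=> a i; case: a => [|[|[|[|[|a]]]]] //=.
- by case: i => [|[|i]] /=; rewrite ?nth_nil; lia.
- by apply: tabE => d; have := ltn_ord (org P d); lia.
- by apply: tabE => d; have := ltn_ord (twin P d); lia.
- by apply: tabE => d; have := ltn_ord (next P d); lia.
by apply: tabE => x; case: crossing; lia.
Qed.

Lemma output_correct m st F : simulates P m st -> invariant P rv st F -> ~~ running st ->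
  exists A B : {set {set V}},
    [/\ E = A :|: B, A :&: B = set0, planar A, forest B & outputs P rv m A B].
Proof.
move=> sim inv not_r; have [treeT T_turn outE] := final_out draw inv not_r.
move: [set d | _] treeT T_turn outE => T treeT T_turn outE; have diagT := tree_diagonals treeT.
have T_real d : d \in T -> real P d.
  by move/(diagonals_crossed diagT)/(crossed_real draw).
have T_far := diagonals_far diagT.
pose S := [set d | real P d && (d \notin T)].
have S_real d : d \in S -> real P d by rewrite inE => /andP[].
have S_far d : d \in S -> far P d \in S.
  rewrite !inE => /andP[rd dT]; rewrite (real_far draw rd) /=.
  by apply: contra dT => /T_far; rewrite (farK draw).
have S_turn d : d \in S -> crossed P d -> turn P d \notin S.
  by rewrite !inE => /andP[_ dT] xd; rewrite T_turn // dT andbF.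
have inS d u : org P d = rv u -> (d \in S) = (d \notin T).
  move=> Eu; rewrite inE; have -> // : real P d.
  by apply/(realP draw); exists u.
exists (drawn P rv S), (drawn P rv T); split.
- apply/setP=> e; rewrite inE; apply/idP/orP=> [eE|[] /drawnP[u [v [d [-> end_d _]]]]].
  + have /eqP/cards2P[u [v [_ Ee]]] := simpleE eE; subst e.
    have [d end_d] := edge_dart draw eE.
    rewrite (drawn_dart draw S_real S_far end_d) (drawn_dart draw T_real T_far end_d).
    by rewrite (inS d u) ?(proj1 end_d) //; case: (d \in T); [right|left].
  + exact: dart_edge end_d.
  + exact: dart_edge end_d.
- apply/setP=> e; rewrite in_set0 inE; apply/andP=> -[/drawnP[u [v [d [-> end_d dS]]]]].
  rewrite (drawn_dart draw T_real T_far end_d); apply/negP.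
  by rewrite -(inS d u) // (proj1 end_d).
- apply: (part_planar draw S_real S_far S_turn) => u v.
  exact: (drawn_card draw S_real S_far u v).
- exact: (tree_forest treeT).
move=> u v d Eu Ev; have end_d := conj Eu Ev.
rewrite (drawn_dart draw S_real S_far end_d) (drawn_dart draw T_real T_far end_d).
by rewrite (inS d u) // (sim_out sim) outE; case: (d \in T).
Qed.

End Correctness.

Theorem theorem9 :
  exists (prog : com) (c k : nat),
  forall (V : finType) (E : {set {set V}}) (nv nd : nat)
    (P : planarization 'I_nv 'I_nd) (rv : V -> 'I_nv),
  simple_graph E -> connected_graph E -> one_planar_drawing E P rv ->
  exists (t : nat) (m : memory),
  [/\ exec (#|V|.+1 ^ k) prog (input P) t m,
      t <= c * #|V|
    & exists A B : {set {set V}},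
        [/\ E = A :|: B, A :&: B = set0, planar A, forest B
          & outputs P rv m A B]].
Proof.
pose q := (cost running_e + time step_c).+1.
(* Since [nd <= 32 * #|V|] and [nv <= #|V| + nd], the input values are at most
   [nv + nd + 1 <= 66 * #|V|], and [3 * nd <= 96 * #|V|] iterations raise this by [stores step_c]
   each. One final test gives the factor 97 in the time. Nonemptiness of [V] absorbs the additive
   ones. *)
pose K := (expr_size running_e + com_size step_c) * (66 + 96 * stores step_c).
exists (While running_e step_c), (97 * q), K.+1 => V E nv nd P rv simpleE [V0 _] draw.
pose Inv n m := exists st F, [/\ simulates P m st, invariant P rv st F & progress st + n = 3 * nd].
have step n m : Inv n m -> eval m running_e != 0 -> 0 < n /\ Inv n.-1 (run step_c m).
  case=> st [F [sim inv En]]; rewrite (sim_running sim) => r.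
  have [[F1 inv1] Ep] := invariant_step draw inv r.
  have := progress_bound inv1; rewrite Ep => le_p.
  split; first by move: le_p; rewrite -En; lia.
  exists (step P st), F1; split=> //; first exact: (sim_step draw sim r).
  by rewrite Ep; move: le_p; rewrite -En; lia.
have le_nd := dart_bound simpleE draw; have le_nv := vertex_bound draw.
have tame_step : tame step_c by [].
have inv0 : Inv (3 * nd) (input P).
  by exists (init_state _ _), set0; split; [exact: sim_init | exact: (invariant_init draw) |].
(* A constant factor is absorbed by the exponent, as the base is at least two. *)
have lt_exp k : k * #|V|.+1 < #|V|.+1 ^ k.+1.
  by rewrite expnS mulnC ltn_pmul2l // ltn_expl.
have M0 : 0 < nv + nd + 1 by rewrite addn1.
have fit : (expr_size running_e + com_size step_c) * (nv + nd + 1 + stores step_c * (3 * nd))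
    < #|V|.+1 ^ K.+1.
  apply: (@leq_ltn_trans (K * #|V|)).
    rewrite /K -mulnA leq_mul2l mulnDl; apply/orP; right; apply: leq_add.
      by move: le_nd le_nv V0; lia.
    by rewrite [96 * _]mulnC -mulnA leq_mul2l; apply/orP; right; move: le_nd; lia.
  apply: (@leq_ltn_trans (K * #|V|.+1)); first by rewrite leq_mul2l leqnSn orbT.
  exact: lt_exp.
have [t [m [ex [n [st [F [sim inv _]]]] e0 le_t]]] :=
  while_exec tame_step step inv0 M0 (input_bound P) fit.
exists t, m; split; [exact: ex | | ].
  apply: leq_trans le_t _; rewrite -/q mulnAC leq_mul2r; apply/orP; right.
  by move: le_nd V0; lia.
by apply: (output_correct simpleE draw sim inv); rewrite -(sim_running sim) e0.
Qed.
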